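(* Let $n\ge1$, $z=(z_1,\dots,z_n)$, $t$ a formal parameter, and $P(z)\in\mathbb{C}[[z]]$ with $o(P(z))\ge2$. Let $Q_t(z)\in\mathbb{C}[[z,t]]$ with $o(Q_t(z))\ge2$ be such that $z+t\nabla Q_t(z)$ is the formal inverse of $z-t\nabla P(z)$, and write $Q_t(z)=\sum_{m=1}^\infty Q_{[m]}(z)t^{m-1}$. Let $Q(z)\in\mathbb{C}[[z]]$ with $o(Q(z))\ge2$ be such that $z+\nabla Q(z)$ is the formal inverse of $z-\nabla P(z)$. Then for any $m\ge1$, $$Q_{[m]}(z)=\sum_{T\in\mathbb{B}_{2m-1}}\frac{1}{\beta(T)}Q_T(z)=\sum_{\substack{T\in\mathbb{B}\\ l(T)=m}}\frac1{\beta(T)}Q_T(z).$$ Therefore $$Q_t(z)=\sum_{T\in\mathbb{B}\setminus\{\emptyset\}}\frac{t^{l(T)-1}}{\beta(T)}Q_T(z),$$ $$Q(z)=\sum_{T\in\mathbb{B}\setminus\{\emptyset\}}\frac{1}{\beta(T)}Q_T(z).$$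
   Context: Power series: $\nabla$ is the gradient with respect to $z$; $\langle a,b\rangle=\sum_i a_ib_i$; $o(\cdot)$ is the lowest total degree in $z$ of a monomial that occurs; composition of formal maps is in $z$ with $t$ treated as a constant, and formal inverses are two-sided. Trees: a rooted tree is a finite 1-connected graph (a finite tree) with one vertex designated as root; the empty set is also viewed as a rooted tree, $\emptyset$. A vertex $w$ is a child of $v$ if they are joined by an edge and $w$ is further from the root than $v$; a leaf is a vertex with no children. A rooted tree is binary if every non-leaf vertex has exactly two children. Isomorphisms are root-preserving (children are unordered). $\mathbb{B}$ is the set of isomorphism classes of binary rooted trees, and $\mathbb{B}_k$ the set of those with $k$ vertices. $\circ$ is the rooted tree with one vertex. $|T|$ is the number of vertices of $T$, $l(T)$ the number of leaves, $\alpha(T)=|\mathrm{Aut}(T)|$, and $\widehat T$ is the rooted tree obtained from $T$ by deleting all its leaves (so $\widehat\circ=\emptyset$). $B_+(T_1,\dots,T_d)$ is the rooted tree obtained by joining the roots of $T_1,\dots,T_d$ to a single new vertex, which is the root of the new tree. The tree factorial is defined by $\emptyset!=1$, $\circ!=1$, and $T!=|T|\,T_1!\,T_2!\cdots T_d!$ for $T=B_+(T_1,\dots,T_d)$. For a binary rooted tree $T$, $\beta(T)=\alpha(T)\,\widehat T!$. For each non-empty binary rooted tree $T$, $Q_T(z)\in\mathbb{C}[[z]]$ is defined by $Q_\circ(z)=P(z)$ and $Q_T(z)=\langle\nabla Q_{T_1}(z),\nabla Q_{T_2}(z)\rangle$ for $T=B_+(T_1,T_2)$.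
   Formalization: The last formula, for Q(z), is stated when its sum over trees exists formally in C[[z]] (each monomial occurs in finitely many terms), which is shown to hold if o(P)≥3; for o(P)=2 it can fail, e.g. n=1, P=z^2, where Q=-z^2 but the sum diverges. *)

(* Defs.v *)
From HB Require Import structures.
From mathcomp Require Import all_boot all_order all_algebra generic_quotient.
From mathcomp Require Import mpoly.
From mathcomp Require Import boolp classical_sets functions cardinality fsbigop.
From mathcomp Require Import reals complex.

Set Implicit Arguments.
Unset Strict Implicit.
Unset Printing Implicit Defensive.

Import GRing.Theory.
Local Open Scope ring_scope.

Record fps (n : nat) (R : Type) := FPS { fcoef :> 'X_{1..n} -> R }.

Lemma fpsP n (R : Type) (f g : fps n R) : f =1 g -> f = g.
Proof. by case: f g => f [g] /= /funext ->. Qed.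

HB.instance Definition _ n R := gen_eqMixin (fps n R).
HB.instance Definition _ n R := gen_choiceMixin (fps n R).

Section FpsZmod.
Variables (n : nat) (R : zmodType).
Implicit Types f g h : fps n R.

Definition fps0 : fps n R := FPS (fun _ => 0).
Definition fps_opp f : fps n R := FPS (fun m => - f m).
Definition fps_add f g : fps n R := FPS (fun m => f m + g m).

Fact fps_addA : associative fps_add.
Proof. by move=> f g h; apply: fpsP => m /=; rewrite addrA. Qed.
Fact fps_addC : commutative fps_add.
Proof. by move=> f g; apply: fpsP => m /=; rewrite addrC. Qed.
Fact fps_add0 : left_id fps0 fps_add.
Proof. by move=> f; apply: fpsP => m /=; rewrite add0r. Qed.
Fact fps_addN : left_inverse fps0 fps_opp fps_add.
Proof. by move=> f; apply: fpsP => m /=; rewrite addNr. Qed.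

HB.instance Definition _ :=
  GRing.isZmodule.Build (fps n R) fps_addA fps_addC fps_add0 fps_addN.
End FpsZmod.

Section FpsRing.
Variables (n : nat) (R : comNzRingType).
Implicit Types f g h : fps n R.

Definition fpsC (c : R) : fps n R := FPS (fun m => if m == 0%MM then c else 0).

(* The Cauchy product; both factors of [m] have degree at most [mdeg m]. *)
Definition fps_mul f g : fps n R := FPS (fun m =>
  \sum_(k : 'X_{1..n < (mdeg m).+1, (mdeg m).+1} | m == (k.1 + k.2)%MM)
    f k.1 * g k.2).

Definition fps_trunc d f : {mpoly R[n]} :=
  \sum_(k : 'X_{1..n < d}) f k *: 'X_[k].

Lemma fps_truncE d f m : (mdeg m < d)%N -> (fps_trunc d f)@_m = f m.
Proof.
move=> lt_md; rewrite /fps_trunc raddf_sum /=.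
rewrite (bigD1 (BMultinom lt_md)) //= mcoeffZ mcoeffX eqxx mulr1.
rewrite big1 ?addr0 // => k; rewrite mcoeffZ mcoeffX -val_eqE /=.
by case: eqP => // _ _; rewrite mulr0.
Qed.

Lemma fps_mul_trunc d f g m : (mdeg m < d)%N ->
  fps_mul f g m = (fps_trunc d f * fps_trunc d g)@_m.
Proof.
move=> lt_md; rewrite mcoeffM /=; apply: eq_bigr => k _.
by rewrite !fps_truncE //; apply: (leq_trans (bmdeg _)).
Qed.

Fact fps_mulC : commutative fps_mul.
Proof.
by move=> f g; apply: fpsP => m; rewrite !(@fps_mul_trunc _ _ _ _ (ltnSn _)) mulrC.
Qed.

Fact fps_mulA : associative fps_mul.
Proof.
move=> f g h; apply: fpsP => m.
pose t := fps_trunc (mdeg m).+1.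
have E1 : fps_mul f (fps_mul g h) m = (t f * (t g * t h))@_m.
  rewrite mcoeffM /=; apply: eq_bigr => k _; congr (_ * _).
    by rewrite fps_truncE // bmdeg.
  exact/fps_mul_trunc/bmdeg.
have E2 : fps_mul (fps_mul f g) h m = (t f * t g * t h)@_m.
  rewrite mcoeffM /=; apply: eq_bigr => k _; congr (_ * _).
    exact/fps_mul_trunc/bmdeg.
  by rewrite fps_truncE // bmdeg.
by rewrite E1 E2 mulrA.
Qed.

Fact fps_mul1 : left_id (fpsC 1) fps_mul.
Proof.
move=> f; apply: fpsP => m; rewrite (@fps_mul_trunc _ _ _ _ (ltnSn _)).
set d := (mdeg m).+1; have -> : fps_trunc d (fpsC 1) = 1.
  apply/mpolyP => k; rewrite mcoeff1.
  have [lt_kd|le_dk] := ltnP (mdeg k) d.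
    by rewrite fps_truncE //=; case: eqP.
  rewrite /fps_trunc raddf_sum /= big1 => [|j _].
    by case: eqP le_dk => // ->; rewrite mdeg0.
  rewrite mcoeffZ mcoeffX; case: (_ =P k) => [jk|_]; last by rewrite mulr0.
  by move: le_dk; rewrite -jk leqNgt bmdeg.
by rewrite mul1r fps_truncE.
Qed.

Fact fps_mulDl : left_distributive fps_mul +%R.
Proof.
move=> f g h; apply: fpsP => m /=; rewrite -big_split /=.
by apply: eq_bigr => k _; rewrite mulrDl.
Qed.

Fact fps1_neq0 : fpsC 1 != 0.
Proof.
apply/eqP => /(congr1 (fun f : fps n R => f 0%MM)) /=.
by rewrite eqxx; apply/eqP/oner_neq0.
Qed.

HB.instance Definition _ := GRing.Zmodule_isComNzRing.Build (fps n R)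
  fps_mulA fps_mulC fps_mul1 fps_mulDl fps1_neq0.

Definition fps_scale (c : R) f : fps n R := FPS (fun m => c * f m).

Fact fps_scaleA a b f : fps_scale a (fps_scale b f) = fps_scale (a * b) f.
Proof. by apply: fpsP => m /=; rewrite mulrA. Qed.
Fact fps_scale1 : left_id 1 fps_scale.
Proof. by move=> f; apply: fpsP => m /=; rewrite mul1r. Qed.
Fact fps_scaleDr : right_distributive fps_scale +%R.
Proof. by move=> c f g; apply: fpsP => m /=; rewrite mulrDr. Qed.
Fact fps_scaleDl f : {morph fps_scale^~ f : a b / a + b}.
Proof. by move=> a b; apply: fpsP => m /=; rewrite mulrDl. Qed.

HB.instance Definition _ := GRing.Zmodule_isLmodule.Build R (fps n R)
  fps_scaleA fps_scale1 fps_scaleDr fps_scaleDl.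

Definition fvar (i : 'I_n) : fps n R :=
  FPS (fun m => if m == U_(i)%MM then 1 else 0).

Definition fderiv (i : 'I_n) f : fps n R :=
  FPS (fun m => f (m + U_(i))%MM *+ (m i).+1).

(* o(f) >= d, with o(0) = +oo *)
Definition ord_ge (d : nat) f := forall m, f m != 0 -> (d <= mdeg m)%N.

Definition dotp (a b : 'I_n -> fps n R) : fps n R := \sum_i a i * b i.

Definition grad f : 'I_n -> fps n R := fun i => fderiv i f.

End FpsRing.

(* Substitution f(g_1, ..., g_n). It is meaningful when no g_i has a constant *)
(* term: then a monomial of f of degree larger than that of m does not        *)
(* contribute to the coefficient of m.                                        *)
Definition fsubst n p (R : comNzRingType) (f : fps n R) (g : 'I_n -> fps p R) :
    fps p R :=
  FPS (fun m => \sum_(k : 'X_{1..n < (mdeg m).+1})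
                  f k * (\prod_i g i ^+ (k : 'X_{1..n}) i) m).

Definition formal_inverse n (R : comNzRingType) (F G : 'I_n -> fps n R) :=
  forall i, fsubst (F i) G = fvar R i /\ fsubst (G i) F = fvar R i.

(* C[[z,t]] is fps n.+1: the last variable is t, and lift ord_max i is z_i. *)

Section FpsT.
Variables (n : nat) (R : comNzRingType).
Implicit Types f g : fps n.+1 R.

Definition tvar : fps n.+1 R := fvar R ord_max.
Definition zvar (i : 'I_n) : fps n.+1 R := fvar R (lift ord_max i).

Definition mon_zt (a : 'X_{1..n}) (k : nat) : 'X_{1..n.+1} :=
  [multinom oapp a k (unlift ord_max j) | j < n.+1].

Definition zpart (m : 'X_{1..n.+1}) : 'X_{1..n} :=
  [multinom m (lift ord_max i) | i < n].

Definition zord_ge (d : nat) f :=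
  forall m, f m != 0 -> (d <= mdeg (zpart m))%N.

Definition zgrad f : 'I_n -> fps n.+1 R := fun i => fderiv (lift ord_max i) f.

Definition inj_z (f : fps n R) : fps n.+1 R :=
  FPS (fun m => if m ord_max == 0%N then f (zpart m) else 0).

(* the coefficient of t^k, as a series in z *)
Definition tcoef (k : nat) f : fps n R := FPS (fun a => f (mon_zt a k)).

(* Composition in z with t kept constant: substitute t for itself. *)
Definition zsubst f (G : 'I_n -> fps n.+1 R) : fps n.+1 R :=
  fsubst f (fun j => oapp G tvar (unlift ord_max j)).

Definition zformal_inverse (F G : 'I_n -> fps n.+1 R) :=
  forall i, zsubst (F i) G = zvar i /\ zsubst (G i) F = zvar i.

End FpsT.
Arguments tvar {n R}.
Arguments zvar {n R} i.

(* Infinite sums are formal: a family is summable when every monomial occurs  *)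
(* in finitely many members only. The value of fps_sum on a family that is    *)
(* not summable is meaningless.                                               *)
Section FpsSum.
Variables (n : nat) (R : comNzRingType) (I : choiceType).
Local Open Scope classical_set_scope.

Definition fps_summable (A : set I) (F : I -> fps n R) :=
  forall m, finite_set [set i | A i /\ F i m != 0].

Definition fps_sum (A : set I) (F : I -> fps n R) : fps n R :=
  FPS (fun m => \sum_(i \in A) F i m).

End FpsSum.

(* Non-empty rooted trees are encoded with their children listed in an order; *)
(* this order is forgotten by the isomorphisms below.                         *)
Inductive ptree : Type := Bplus of seq ptree.

HB.instance Definition _ := gen_eqMixin ptree.
HB.instance Definition _ := gen_choiceMixin ptree.

(* [None] is the empty tree. *)
Definition rtree := option ptree.
HB.instance Definition _ := Choice.on rtree.

(* A vertex is named by the path leading to it from the root: [::] is the     *)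
(* root, and i :: v is the vertex v of the i-th subtree.                      *)
Fixpoint pverts (T : ptree) : seq (seq nat) :=
  let: Bplus Ts := T in
  [::] :: (fix go (i : nat) (Ts : seq ptree) :=
             if Ts is T1 :: Ts' then map (cons i) (pverts T1) ++ go i.+1 Ts'
             else [::]) 0%N Ts.

Definition verts (T : rtree) : seq (seq nat) := oapp pverts [::] T.
Definition vertex (T : rtree) : finType := seq_sub (verts T).

Section Vertices.
Variable T : rtree.
Implicit Types v w : vertex T.

Definition is_root v := val v == [::].
Definition child v w :=
  prefix (val v) (val w) && (size (val w) == (size (val v)).+1).
Definition adjacent v w := child v w || child w v.
Definition is_leaf v := [forall w, ~~ child v w].

Definition nverts := #|vertex T|.
Definition nleaves := #|[set v | is_leaf v]|.
Definition is_binary := [forall v, is_leaf v || (#|[set w | child v w]| == 2%N)].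
End Vertices.

Definition isos (T T' : rtree) : {set {ffun vertex T -> vertex T'}} :=
  [set f : {ffun vertex T -> vertex T'} |
    [&& injectiveb f, [forall y, exists x, f x == y],
        [forall x, is_root (f x) == is_root x] &
        [forall x, forall y, adjacent (f x) (f y) == adjacent x y]]].

Definition isomorphic (T T' : rtree) := [exists f, f \in isos T T'].

Definition alpha (T : rtree) : nat := #|isos T T|.

Fixpoint pprune (T : ptree) : rtree :=
  match T with
  | Bplus [::] => None
  | Bplus Ts => Some (Bplus (pmap pprune Ts))
  end.
(* T with all its leaves deleted *)
Definition prune (T : rtree) : rtree := obind pprune T.

Fixpoint ptfact (T : ptree) : nat :=
  let: Bplus Ts := T in
  (nverts (Some T) * \prod_(k <- map ptfact Ts) k)%N.
Definition tfact (T : rtree) : nat := oapp ptfact 1%N T.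

Definition beta (T : rtree) : nat := (alpha T * tfact (prune T))%N.

Lemma isosP T T' (f : {ffun vertex T -> vertex T'}) :
  reflect [/\ bijective f, forall x, is_root (f x) = is_root x &
             forall x y, adjacent (f x) (f y) = adjacent x y]
          (f \in isos T T').
Proof.
rewrite inE; apply: (iffP and4P) => [[/injectiveP fi /forallP fs fr fa]|].
  have fs' y : {x | f x == y} by apply: sigW; exact/existsP.
  split=> [|x|x y].
  - exists (fun y => sval (fs' y)) => [x|y]; last exact/eqP/(svalP (fs' y)).
    exact/fi/eqP/(svalP (fs' (f x))).
  - by move/forallP: fr => /(_ x)/eqP.
  - by move/forallP: fa => /(_ x)/forallP/(_ y)/eqP.
case=> -[g gK fK] fr fa; split.
- exact/injectiveP/(can_inj gK).
- by apply/forallP => y; apply/existsP; exists (g y); rewrite fK.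
- by apply/forallP => x; rewrite fr.
- by apply/forallP => x; apply/forallP => y; rewrite fa.
Qed.

Lemma isomorphicP T T' : reflect
  (exists f : vertex T -> vertex T',
    [/\ bijective f, forall x, is_root (f x) = is_root x &
        forall x y, adjacent (f x) (f y) = adjacent x y])
  (isomorphic T T').
Proof.
apply: (iffP existsP) => [[f /isosP fP]|[f [fb fr fa]]]; first by exists f.
exists (finfun f); apply/isosP; split=> [|x|x y]; rewrite ?ffunE //.
by apply: (eq_bij fb) => x; rewrite ffunE.
Qed.

Definition btree := {T : rtree | is_binary T}.
HB.instance Definition _ := Choice.on btree.

Definition biso (T T' : btree) := isomorphic (val T) (val T').

Fact biso_refl : reflexive biso.
Proof. by move=> T; apply/isomorphicP; exists id; split=> //; exists id. Qed.

Fact biso_sym : ssrbool.symmetric biso.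
Proof.
suff H T T' : biso T T' -> biso T' T by move=> T T'; apply/idP/idP; exact: H.
move=> /isomorphicP[f [[g gK fK] fr fa]]; apply/isomorphicP; exists g.
by split=> [|x|x y]; [exists f | rewrite -fr fK | rewrite -fa !fK].
Qed.

Fact biso_trans : transitive biso.
Proof.
move=> T1 T2 T3 /isomorphicP[f [fb fr fa]] /isomorphicP[g [gb gr ga]].
apply/isomorphicP; exists (g \o f); split=> [|x|x y] /=.
- exact: bij_comp.
- by rewrite gr fr.
- by rewrite ga fa.
Qed.

Canonical biso_equiv := EquivRel biso biso_refl biso_sym biso_trans.

(* The set of isomorphism classes of binary rooted trees; a class is read     *)
(* through a representative wherever a rooted tree is expected.               *)
Definition BB := {eq_quot biso}%qT.
HB.instance Definition _ := Choice.on BB.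
HB.instance Definition _ := EqQuotient.on BB.
Definition BBrep (T : BB) : rtree := val (repr T).
Coercion BBrep : BB >-> rtree.

Fact empty_binary : is_binary None.
Proof. by apply/forallP => -[]. Qed.
Definition BBempty : BB := (\pi_BB (exist _ None empty_binary))%qT.

Section BBSets.
Local Open Scope classical_set_scope.
Definition BB_nverts (k : nat) : set BB := [set T : BB | nverts T = k].
Definition BB_nleaves (m : nat) : set BB := [set T : BB | nleaves T = m].
Definition BB_nonempty : set BB := [set~ BBempty].
End BBSets.

(* The last branch is not reached on binary trees. *)
Fixpoint pQtree n (R : comNzRingType) (P : fps n R) (T : ptree) : fps n R :=
  match T with
  | Bplus [::] => P
  | Bplus [:: T1; T2] => dotp (grad (pQtree P T1)) (grad (pQtree P T2))
  | _ => 0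
  end.
(* The value at the empty tree is a placeholder. *)
Definition Qtree n (R : comNzRingType) (P : fps n R) (T : rtree) : fps n R :=
  oapp (pQtree P) 0 T.

(* Main.v *)
(** Differentiating [grad Q_t (z - t grad P) = grad P] in [t] and substituting
    the inverse map back shows that [Q_t] solves the inviscid Burgers equation
    [2 d/dt Q_t = <grad Q_t, grad Q_t>] with [Q_0 = P].  Its coefficients thus
    satisfy [2 m Q_[m+1] = sum_(k + l = m + 1) <grad Q_[k], grad Q_[l]>].

    On planar binary trees [p] with [m] leaves, the sum of [Q_p] with weights
    [1 / (2^(m-1) phat!)] satisfies the same recursion, because
    [phat! = (m - 1) ahat! bhat!] for [p = B_+(a, b)].  Counting the
    isomorphisms from a fixed tree to all planar trees shows that the class of
    [T] contains [2^(m-1) / alpha(T)] planar trees, so the planar sum is the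
    sum over classes with weights [1 / beta(T)].

    If the sum at [t = 1] is summable, every coefficient in [z] of [Q_t] is a
    polynomial in [t]; [Q_t] then lives in [C[t][[z]]], where [t] can be
    specialized to 1, and uniqueness of inverses identifies the result with
    [Q]. *)

From HB Require Import structures.
Require Import Defs.
From mathcomp Require Import all_boot all_order all_algebra.
From mathcomp Require Import zify ring mpoly.
From mathcomp Require Import boolp classical_sets functions cardinality fsbigop.
From mathcomp Require Import reals complex.

Set Implicit Arguments.
Unset Strict Implicit.
Unset Printing Implicit Defensive.

Import GRing.Theory Num.Theory.
Local Open Scope ring_scope.

(** * Substitution of formal power series *)

(** The obstacle at t = 1 is that a monomial in z may carry infinitely many powers of t. This does
    occur when P has order 2: for n = 1 and P = z^2 every Q_T is a nonzero multiple of z^2, so the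
    family of all trees is not summable. From order 3 on, the order of Q_T grows with the number of
    leaves.

    The Burgers equation is derived for gradients, where the inverse map gives information; the
    series themselves are recovered from characteristic 0 and vanishing constant terms.

    The factor 2 in the recursion comes from d_i <u, u> = 2 sum_j u_j d_i u_j, where u = grad Q_t
    and d_i u_j = d_j u_i. On the tree side it counts the two orders of the children of an inner
    vertex; a binary tree with m leaves has m - 1 inner vertices, hence 2^(m-1).

    Leibniz rule, chain rule and multiplicativity of substitution are continuous for the degree
    filtration, so that they need checking on polynomials or monomials only. *)

Lemma mnm_ind n (Q : 'X_{1..n} -> Prop) :
  Q 0%MM -> (forall i m, Q m -> Q (U_(i) + m)%MM) -> forall m, Q m.
Proof.
move=> Q0 QS m; have [d le_d] := ubnP (mdeg m); elim: d => // d IH in m le_d *.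
have [->//|] := eqVneq m 0%MM; rewrite -mdeg_eq0 mdegE sum_nat_eq0 negb_forall.
case/existsP => i /=; rewrite -lt0n => mi_gt0.
have Em : m = (U_(i) + (m - U_(i)))%MM.
  rewrite addmC submK //; apply/mnm_lepP => j.
  by rewrite mnm1E; case: eqP => // <-.
rewrite Em; apply/QS/IH; move: le_d.
by rewrite {1}Em mdegD mdeg1.
Qed.

Section Monomials.
Variables (n : nat) (R : comNzRingType).
Implicit Types (f g h : fps n R) (k m : 'X_{1..n}).

Lemma fpsDE f g m : (f + g) m = f m + g m. Proof. by []. Qed.
Lemma fpsBE f g m : (f - g) m = f m - g m. Proof. by []. Qed.
Lemma fpsZE c f m : (c *: f) m = c * f m. Proof. by []. Qed.
Lemma fps1E m : (1 : fps n R) m = (m == 0%MM)%:R.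
Proof. by rewrite /GRing.one /=; case: eqP. Qed.

Lemma fps_sumE I (r : seq I) (Q : pred I) (F : I -> fps n R) m :
  (\sum_(i <- r | Q i) F i) m = \sum_(i <- r | Q i) F i m.
Proof. exact: (big_morph (fun f : fps n R => f m)). Qed.

Lemma fpsMnE f j m : (f *+ j) m = f m *+ j.
Proof. by elim: j => // j IH; rewrite !mulrS fpsDE IH. Qed.

Definition fps_of_mpoly (p : {mpoly R[n]}) : fps n R := FPS (fun m => p@_m).

Lemma fps_of_mpolyM p q :
  fps_of_mpoly (p * q) = fps_of_mpoly p * fps_of_mpoly q.
Proof. by apply: fpsP => m; rewrite /= mcoeffM. Qed.

Definition fmono k : fps n R := FPS (fun m => (m == k)%:R).

Lemma fmonoE k : fmono k = fps_of_mpoly 'X_[k].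
Proof. by apply: fpsP => m; rewrite /= mcoeffX eq_sym. Qed.

Lemma fmonoD k m : fmono (k + m)%MM = fmono k * fmono m.
Proof. by rewrite !fmonoE mpolyXD fps_of_mpolyM. Qed.

Lemma fmono0 : fmono 0%MM = 1.
Proof. by apply: fpsP => m; rewrite fps1E. Qed.

Lemma fvarE i : fvar R i = fmono U_(i)%MM.
Proof. by apply: fpsP => m /=; case: eqP. Qed.

Definition eq_below d f g := forall m, (mdeg m < d)%N -> f m = g m.

Lemma eq_below_refl d f : eq_below d f f. Proof. by []. Qed.

Lemma eq_belowD d f f' g g' :
  eq_below d f f' -> eq_below d g g' -> eq_below d (f + g) (f' + g').
Proof. by move=> ff gg m lt_md; rewrite !fpsDE ff ?gg. Qed.

Lemma eq_below_sum d I (r : seq I) (F G : I -> fps n R) :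
  (forall i, eq_below d (F i) (G i)) ->
  eq_below d (\sum_(i <- r) F i) (\sum_(i <- r) G i).
Proof.
by move=> FG m lt_md; rewrite !fps_sumE; apply: eq_bigr => i _; apply: FG.
Qed.

Lemma eq_belowM d f f' g g' :
  eq_below d f f' -> eq_below d g g' -> eq_below d (f * g) (f' * g').
Proof.
move=> ff gg m lt_md; apply: eq_bigr => k _.
by rewrite ff ?gg //; apply: leq_trans lt_md; rewrite ltnS -ltnS bmdeg.
Qed.

(** A finite combination of monomials, to which linear maps apply term by term; through [fps_cutE]
    it also imports the rules of [{mpoly R[n]}]. *)
Definition fps_cut d f : fps n R := \sum_(k : 'X_{1..n < d}) f k *: fmono k.

Lemma fps_cutE d f : fps_cut d f = fps_of_mpoly (fps_trunc d f).
Proof.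
apply: fpsP => m; rewrite fps_sumE /= /fps_trunc raddf_sum /=.
by apply: eq_bigr => k _; rewrite mcoeffZ mcoeffX /= eq_sym.
Qed.

Lemma fps_cut_below d f : eq_below d f (fps_cut d f).
Proof. by move=> m lt_md; rewrite fps_cutE /= fps_truncE. Qed.

Lemma fmonoMl k f m : (fmono k * f) (k + m)%MM = f m.
Proof.
set d := (mdeg (k + m)).+1.
rewrite (eq_belowM (@eq_below_refl d _) (@fps_cut_below d f)) //.
rewrite fps_cutE fmonoE -fps_of_mpolyM /= mulrC mcoeffMX fps_truncE //.
by rewrite ltnS mdegD leq_addl.
Qed.

Lemma fmonoMl_out k f m : ~~ (k <= m)%MM -> (fmono k * f) m = 0.
Proof.
move=> nkm; apply: big1 => -[a b] /= /eqP E.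
case: eqP => [ak|_]; last by rewrite mul0r.
by case/negP: nkm; move/esym: E; rewrite ak => <-; apply: lem_addr.
Qed.

Lemma fps_scaleE c f : c *: f = fpsC n c * f.
Proof.
apply: fpsP => m; have -> : fpsC n c = c *: (1 : fps n R).
  by apply: fpsP => k; rewrite fpsZE fps1E /=; case: eqP; rewrite ?mulr1 ?mulr0.
rewrite fpsZE -[X in c * X](congr1 (fun g : fps n R => g m) (mul1r f)).
by rewrite /= big_distrr /=; apply: eq_bigr => k _; rewrite mulrA.
Qed.

Lemma fps_scalerAl c f g : c *: (f * g) = c *: f * g.
Proof. by rewrite !fps_scaleE mulrA. Qed.

Lemma fps_scalerAr c f g : c *: (f * g) = f * (c *: g).
Proof. by rewrite !fps_scaleE mulrCA. Qed.

Lemma fps_mul_coef0 f g : (f * g) 0%MM = f 0%MM * g 0%MM.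
Proof.
have E h : eq_below 1 h (fps_of_mpoly (h 0%MM)%:MP).
  move=> m; rewrite ltnS leqn0 mdeg_eq0 => /eqP->.
  by rewrite /= mcoeffC eqxx mulr1.
rewrite (eq_belowM (E f) (E g)) ?mdeg0 // -fps_of_mpolyM -mpolyCM /=.
by rewrite mcoeffC eqxx mulr1.
Qed.

Lemma ord_geM d e f g : ord_ge d f -> ord_ge e g -> ord_ge (d + e) (f * g).
Proof.
move=> of_ og m; apply: contraNT; rewrite -ltnNge => lt.
apply/eqP/big1 => -[u v] /= /eqP E.
have [->|/of_ lu] := eqVneq (f u) 0; first by rewrite mul0r.
have [->|/og lv] := eqVneq (g v) 0; first by rewrite mulr0.
by have := leq_add lu lv; rewrite -mdegD -E leqNgt lt.
Qed.

End Monomials.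
Arguments fmono {n} R k.

Section Density.
Variables (n p : nat) (R : comNzRingType).

(* Linear, and continuous for the degree filtrations up to a shift by [c]. *)
Definition lin_cont c (L : fps n R -> fps p R) :=
  (forall a f g, L (a *: f + g) = a *: L f + L g) /\
  (forall d f g, eq_below (d + c) f g -> eq_below d (L f) (L g)).

(** Polynomials are dense: for a given coefficient of the image, continuity replaces [f] by a
    truncation, and linearity does the rest. *)
Lemma lin_cont_ext c L1 L2 : lin_cont c L1 -> lin_cont c L2 ->
  (forall k, L1 (fmono R k) = L2 (fmono R k)) -> L1 =1 L2.
Proof.
move=> [lin1 ct1] [lin2 ct2] L12 f; apply: fpsP => m.
pose d := (mdeg m).+1.
have cutf := @fps_cut_below n R (d + c) f.
rewrite (ct1 d _ _ cutf) // (ct2 d _ _ cutf) //; congr (fcoef _ m).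
have lin0 (L : fps n R -> fps p R) :
    (forall a f g, L (a *: f + g) = a *: L f + L g) ->
    forall (r : seq 'X_{1..n < d + c}),
    L (\sum_(k <- r) f k *: fmono R k) = \sum_(k <- r) f k *: L (fmono R k).
  move=> linL; elim => [|k r IH]; last by rewrite !big_cons linL IH.
  (* Linearity at [-1 *: 0 + 0] forces [L 0 = 0]. *)
  rewrite !big_nil; have := linL (- 1) 0 0.
  by rewrite scaler0 addr0 scaleN1r addNr.
by rewrite /fps_cut !lin0 //; apply: eq_bigr => k _; rewrite L12.
Qed.

Lemma lin_cont_mulr c L g : lin_cont c L -> lin_cont c (fun f => L f * g).
Proof.
case=> linL ctL; split=> [a f h|d f h fh].
  by rewrite linL mulrDl fps_scalerAl.
by apply: eq_belowM => //; apply: ctL.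
Qed.

Lemma lin_cont_sum I (r : seq I) c (L : I -> fps n R -> fps p R) :
  (forall i, lin_cont c (L i)) -> lin_cont c (fun f => \sum_(i <- r) L i f).
Proof.
move=> lcL; split=> [a f h|d f h fh].
  rewrite scaler_sumr -big_split /=; apply: eq_bigr => i _.
  by case: (lcL i) => ->.
by apply: eq_below_sum => i; case: (lcL i) => _; apply.
Qed.

End Density.

Lemma lin_cont_comp n p q (R : comNzRingType) c d
    (L : fps n R -> fps p R) (M : fps p R -> fps q R) :
  lin_cont c L -> lin_cont d M -> lin_cont (d + c) (M \o L).
Proof.
move=> [linL ctL] [linM ctM]; split=> [a f g|e f g fg] /=.
  by rewrite linL linM.
by apply/ctM/ctL; rewrite -addnA.
Qed.

Lemma lin_cont_id n (R : comNzRingType) : lin_cont 0 (@id (fps n R)).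
Proof. by split=> // d f g; rewrite addn0. Qed.

Section Deriv.
Variables (n : nat) (R : comNzRingType).
Implicit Types f g : fps n R.

Lemma lin_cont_fderiv (i : 'I_n) : lin_cont 1 (@fderiv n R i).
Proof.
split=> [a f g|d f g fg m lt_md].
  by apply: fpsP => m /=; rewrite mulrnDl mulrnAr.
by rewrite /= fg // mdegD mdeg1 ltn_add2r.
Qed.

Lemma fderivD i : {morph @fderiv n R i : f g / f + g}.
Proof. by move=> f g; apply: fpsP => m; rewrite /= mulrnDl. Qed.

Lemma fderivZ i c f : fderiv i (c *: f) = c *: fderiv i f.
Proof. by apply: fpsP => m; rewrite /= mulrnAr. Qed.

Lemma fderivB i : {morph @fderiv n R i : f g / f - g}.
Proof. by move=> f g; apply: fpsP => m; rewrite /= mulrnBl. Qed.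

Lemma fderiv0 i : fderiv i (0 : fps n R) = 0.
Proof. by apply: fpsP => m /=; rewrite mul0rn. Qed.

Lemma fderiv_sum i I (r : seq I) (Q : pred I) (F : I -> fps n R) :
  fderiv i (\sum_(j <- r | Q j) F j) = \sum_(j <- r | Q j) fderiv i (F j).
Proof. by apply: (big_morph (fderiv i)); [exact: fderivD | exact: fderiv0]. Qed.

(** Truncation reduces this to polynomials; the cut is one degree further out because a derivative
    lowers degrees by one. *)
Lemma fderivM i f g : fderiv i (f * g) = fderiv i f * g + f * fderiv i g.
Proof.
have fderiv_poly (p : {mpoly R[n]}) :
    fderiv i (fps_of_mpoly p) = fps_of_mpoly (p^`M(i)).
  by apply: fpsP => m; rewrite /= mcoeff_deriv.
apply: fpsP => m; set d := (mdeg m).+1.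
have [_ ct] := lin_cont_fderiv i.
have [cf cg] := (@fps_cut_below n R (d + 1) f, @fps_cut_below n R (d + 1) g).
have weak (h h' : fps n R) : eq_below (d + 1) h h' -> eq_below d h h'.
  by move=> hh k lt_kd; apply: hh; apply: ltn_addr.
rewrite (ct d _ _ (eq_belowM cf cg)) //.
rewrite (eq_belowD (eq_belowM (ct _ _ _ cf) (weak _ _ cg))
                   (eq_belowM (weak _ _ cf) (ct _ _ _ cg))) //.
rewrite !fps_cutE -fps_of_mpolyM !fderiv_poly mderivM -!fps_of_mpolyM.
by rewrite /= mcoeffD.
Qed.

Lemma fderivC i j f : fderiv i (fderiv j f) = fderiv j (fderiv i f).
Proof.
apply: fpsP => m /=; rewrite -!mulrnA !mnmDE !mnm1E.
have -> : (m + U_(i) + U_(j) = m + U_(j) + U_(i))%MM.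
  by rewrite -!addmA (addmC U_(j)%MM).
congr (_ *+ _).
by rewrite eq_sym; case: eqP => [->|_] //; rewrite !addn0 mulnC.
Qed.

Lemma fderiv_var (i j : 'I_n) : fderiv i (fvar R j) = (i == j)%:R.
Proof.
apply: fpsP => m /=; case: (i =P j) => [->|/eqP ne].
  rewrite fps1E -{2}[U_(j)%MM]add0m (inj_eq (@addIm _ _)).
  by case: eqP => [->|_]; rewrite ?mnm0E ?mul0rn.
rewrite ifN ?mul0rn //; apply: contra ne => /eqP/mnmP/(_ i).
by rewrite mnmDE !mnm1E eqxx addn1; case: eqP => [->|].
Qed.

End Deriv.

Section Monomial.
Variables (n p : nat) (R : comNzRingType) (g : 'I_n -> fps p R).

Definition gmono (k : 'X_{1..n}) := \prod_i g i ^+ k i.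

Lemma gmono0 : gmono 0%MM = 1.
Proof. by rewrite /gmono big1 // => i _; rewrite mnm0E. Qed.

Lemma gmonoD j k : gmono (j + k)%MM = gmono j * gmono k.
Proof.
by rewrite /gmono -big_split /=; apply: eq_bigr => i _; rewrite mnmDE exprD.
Qed.

Lemma gmonoU i : gmono U_(i)%MM = g i.
Proof.
rewrite /gmono (bigD1 i) //= mnm1E eqxx expr1 big1 ?mulr1 // => j.
by rewrite mnm1E eq_sym => /negbTE->.
Qed.

End Monomial.

Section Subst.
Variables (n p : nat) (R : comNzRingType) (g : 'I_n -> fps p R).
Hypothesis g0 : forall i, g i 0%MM = 0.
Implicit Types (f h : fps n R) (k m : 'X_{1..n}).

Lemma ord_ge_gmono k : ord_ge (mdeg k) (gmono g k).
Proof.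
rewrite mdegE /gmono; elim/big_rec2: _ => // i a d _ oa.
apply: ord_geM => //; elim: (k i) => // j IH.
rewrite exprS -add1n; apply: ord_geM => // m; apply: contraNT.
by rewrite -ltnNge ltnS leqn0 mdeg_eq0 => /eqP->; rewrite g0.
Qed.

(** By [ord_ge_gmono] the exponents added by a larger bound contribute nothing, so substitutions can
    be compared over a common range. *)
Lemma fsubst_wide d f (m : 'X_{1..p}) : (mdeg m < d)%N ->
  fsubst f g m = \sum_(k : 'X_{1..n < d}) f k * gmono g k m.
Proof.
move=> lt_md; rewrite /= -[LHS]/(\sum_(k : 'X_{1..n < _}) f k * gmono g k m).
rewrite (bigID (fun k : 'X_{1..n < d} => (mdeg k < (mdeg m).+1)%N)) /=.
rewrite [X in _ + X]big1 ?addr0 => [|k]; last first.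
  rewrite -leqNgt => lt_mk; have [->|/ord_ge_gmono] := eqVneq (gmono g k m) 0.
    by rewrite mulr0.
  by rewrite leqNgt lt_mk.
have lt_emb (k : 'X_{1..n < (mdeg m).+1}) : (mdeg k < d)%N.
  exact: leq_trans (bmdeg k) lt_md.
rewrite (reindex (fun k : 'X_{1..n < (mdeg m).+1} => BMultinom (lt_emb k))) /=.
  by apply: eq_bigl => k; rewrite bmdeg.
exists (fun k : 'X_{1..n < d} => insubd (@bm0 n (mdeg m)) (bmnm k)) => k.
  by move=> _; apply/val_inj; rewrite insubdK // -topredE /= bmdeg.
by move=> lt_k; apply/val_inj; rewrite /= insubdK.
Qed.

Lemma lin_cont_fsubst : lin_cont 0 (fun f => fsubst f g).
Proof.
split=> [a f h|d f h fh m lt_md].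
  apply: fpsP => m; rewrite /= big_distrr -big_split /=.
  by apply: eq_bigr => k _; rewrite mulrDl mulrA.
apply: eq_bigr => k _; rewrite fh // addn0.
exact: leq_trans (bmdeg k) lt_md.
Qed.

Lemma fsubstD f h : fsubst (f + h) g = fsubst f g + fsubst h g.
Proof. by have [/(_ 1 f h)] := lin_cont_fsubst; rewrite !scale1r. Qed.

Lemma fsubst0 : fsubst (0 : fps n R) g = 0.
Proof. by apply: fpsP => m /=; rewrite big1 // => k _; rewrite mul0r. Qed.

Lemma fsubstZ c f : fsubst (c *: f) g = c *: fsubst f g.
Proof. by have [/(_ c f 0)] := lin_cont_fsubst; rewrite fsubst0 !addr0. Qed.

Lemma fsubstB f h : fsubst (f - h) g = fsubst f g - fsubst h g.
Proof. by rewrite -!scaleN1r fsubstD fsubstZ. Qed.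

Lemma fsubst_mono k : fsubst (fmono R k) g = gmono g k.
Proof.
apply: fpsP => m; pose d := (maxn (mdeg m) (mdeg k)).+1.
have lt_kd : (mdeg k < d)%N by rewrite ltnS leq_maxr.
rewrite (@fsubst_wide d) ?ltnS ?leq_maxl // (bigD1 (BMultinom lt_kd)) //=.
rewrite eqxx mul1r big1 ?addr0 // => j; rewrite -val_eqE /=.
by case: eqP => //; rewrite mul0r.
Qed.

Lemma fsubst_var i : fsubst (fvar R i) g = g i.
Proof. by rewrite fvarE fsubst_mono gmonoU. Qed.

Lemma fsubst1 : fsubst (1 : fps n R) g = 1.
Proof. by rewrite -fmono0 fsubst_mono gmono0. Qed.

(** Density in one factor at a time, the other being fixed, leaves additivity of exponents. *)
Lemma fsubstM f h : fsubst (f * h) g = fsubst f g * fsubst h g.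
Proof.
have lc := lin_cont_fsubst.
have lcM (u : fps n R) : lin_cont 0 (fun f => fsubst (f * u) g).
  exact: lin_cont_comp (lin_cont_mulr u (@lin_cont_id _ _)) lc.
move: f; apply: (lin_cont_ext (lcM h) (lin_cont_mulr _ lc)) => k.
rewrite mulrC [RHS]mulrC.
move: h; apply: (lin_cont_ext (lcM _) (lin_cont_mulr _ lc)) => j.
by rewrite -fmonoD !fsubst_mono gmonoD.
Qed.

(** Both sides are linear and continuous in [f] and satisfy the same Leibniz rule over the
    substitution, so they agree on monomials once they agree on variables. *)
Lemma fsubst_chain j f :
  fderiv j (fsubst f g) = \sum_i fsubst (fderiv i f) g * fderiv j (g i).
Proof.
pose D h := \sum_i fsubst (fderiv i h) g * fderiv j (g i).
have DM u v : D (u * v) = D u * fsubst v g + fsubst u g * D v.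
  rewrite mulr_suml mulr_sumr -big_split /=; apply: eq_bigr => i _.
  rewrite fderivM fsubstD !fsubstM mulrDl; congr (_ + _); last by rewrite mulrA.
  by rewrite mulrAC.
have lcL := lin_cont_comp lin_cont_fsubst (lin_cont_fderiv R j).
have lcD : lin_cont 1 D.
  apply: lin_cont_sum => i; apply: lin_cont_mulr.
  exact: (lin_cont_comp (lin_cont_fderiv R i) lin_cont_fsubst).
apply: (lin_cont_ext lcL lcD) => k; rewrite /= {lcL lcD}.
elim/mnm_ind: k => [|i k IH].
  (* The Leibniz rule for 1 * 1 reads D 1 = D 1 + D 1. *)
  have d1 q i : fderiv i (1 : fps q R) = 0.
    have := fderivM i (1 : fps q R) 1.
    by rewrite !mulr1 mul1r -[X in X = _]addr0 => /addrI.
  by rewrite fmono0 fsubst1 d1 /D big1 // => i _; rewrite d1 fsubst0 mul0r.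
rewrite fmonoD DM fsubstM fderivM {}IH -fvarE; congr (_ * _ + _).
rewrite fsubst_var /D (bigD1 i) //= fderiv_var eqxx fsubst1 mul1r.
rewrite big1 ?addr0 //.
by move=> l /negbTE nli; rewrite fderiv_var nli fsubst0 mul0r.
Qed.

End Subst.

Lemma lin_cont_weaken n p (R : comNzRingType) c d (L : fps n R -> fps p R) :
  (c <= d)%N -> lin_cont c L -> lin_cont d L.
Proof.
move=> le_cd [linL ctL]; split=> // e f g fg; apply: ctL => m lt_m.
by apply: fg; apply: leq_trans lt_m _; rewrite leq_add2l.
Qed.

Lemma fsubst_coef0 n p (R : comNzRingType) (f : fps n R) (g : 'I_n -> fps p R) :
  (forall i, g i 0%MM = 0) -> fsubst f g 0%MM = f 0%MM.
Proof.
move=> g0; have [_ ct] := lin_cont_fsubst g.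
have f1 : eq_below (1 + 0) f (f 0%MM *: (1 : fps n R)).
  move=> m; rewrite addn0 ltnS leqn0 mdeg_eq0 => /eqP->.
  by rewrite fpsZE fps1E eqxx mulr1.
by rewrite (ct 1%N _ _ f1) ?mdeg0 // fsubstZ fsubst1 // fpsZE fps1E eqxx mulr1.
Qed.

Lemma fsubst_comp n p q (R : comNzRingType) (f : fps n R)
    (g : 'I_n -> fps p R) (h : 'I_p -> fps q R) :
  (forall i, g i 0%MM = 0) -> (forall i, h i 0%MM = 0) ->
  fsubst (fsubst f g) h = fsubst f (fun i => fsubst (g i) h).
Proof.
move=> g0 h0.
have gh0 i : fsubst (g i) h 0%MM = 0 by rewrite fsubst_coef0.
have lcgh := lin_cont_comp (lin_cont_fsubst g) (lin_cont_fsubst h).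
apply: (lin_cont_ext lcgh (lin_cont_fsubst _)) => k /=.
rewrite !fsubst_mono // /gmono.
rewrite (big_morph _ (fsubstM h0) (fsubst1 h0)); apply: eq_bigr => i _.
by elim: (k i) => [|j IH]; rewrite ?fsubst1 // !exprS fsubstM // IH.
Qed.

Lemma fsubst_id n (R : comNzRingType) (f : fps n R) : fsubst f (fvar R) = f.
Proof.
have v0 i : fvar R i 0%MM = 0 :> R by rewrite /= eq_sym mnm1_eq0.
apply: (lin_cont_ext (lin_cont_fsubst _) (@lin_cont_id n R)) => k.
rewrite fsubst_mono //; elim/mnm_ind: k => [|i k IH].
  by rewrite gmono0 fmono0.
by rewrite gmonoD gmonoU IH fmonoD fvarE.
Qed.

Lemma eq_fsubst n p (R : comNzRingType) (f : fps n R) (g h : 'I_n -> fps p R) :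
  g =1 h -> fsubst f g = fsubst f h.
Proof. by move=> /funext->. Qed.

(** A nonconstant monomial is some [U_(i) + m], and its coefficient times [(m i).+1] is a
    coefficient of the i-th derivative; characteristic 0 cancels the factor. *)
Lemma fps_grad_inj n (K : numDomainType) (f g : fps n K) :
  (forall i, fderiv i f = fderiv i g) -> f 0%MM = g 0%MM -> f = g.
Proof.
move=> fg fg0; apply: fpsP; elim/mnm_ind => // i m _.
have /(congr1 (fun h : fps n K => h m)) := fg i.
by rewrite /= addmC => /(pmulrnI (ltn0Sn _)).
Qed.

(** * Series in z and t *)

Section TSeries.
Variables (n : nat) (R : comNzRingType).
Implicit Types (f g : fps n.+1 R) (a b : 'X_{1..n}) (m K J : 'X_{1..n.+1}).

Lemma mon_zt_max a k : mon_zt a k ord_max = k.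
Proof. by rewrite mnmE unlift_none. Qed.

Lemma mon_zt_lift a k i : mon_zt a k (lift ord_max i) = a i.
Proof. by rewrite mnmE liftK. Qed.

Lemma zpart_mon_zt a k : zpart (mon_zt a k) = a.
Proof. by apply/mnmP => i; rewrite mnmE mon_zt_lift. Qed.

Lemma mon_zt_zpart m : mon_zt (zpart m) (m ord_max) = m.
Proof.
by apply/mnmP => j; rewrite mnmE; case: unliftP => [i|] -> //=; rewrite mnmE.
Qed.

Lemma mon_ztP m : exists a k, m = mon_zt a k.
Proof. by exists (zpart m), (m ord_max); rewrite mon_zt_zpart. Qed.

Lemma mon_ztD a b j k : mon_zt (a + b) (j + k) = (mon_zt a j + mon_zt b k)%MM.
Proof.
by apply/mnmP => i; rewrite !mnmE; case: unliftP => [l|] _ //=; rewrite mnmE.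
Qed.

Lemma mon_zt0 : mon_zt 0%MM 0 = 0%MM :> 'X_{1..n.+1}.
Proof.
by apply/mnmP => i; rewrite !mnmE; case: unliftP => [l|] _ //=; rewrite mnmE.
Qed.

Lemma mon_ztU i : mon_zt U_(i) 0 = U_(lift ord_max i)%MM :> 'X_{1..n.+1}.
Proof.
apply/mnmP => j; rewrite !mnmE; case: unliftP => [l|] -> /=.
  by rewrite mnmE (inj_eq lift_inj).
by rewrite eq_sym (negbTE (neq_lift _ _)).
Qed.

Lemma mon_zt01 : mon_zt 0%MM 1 = U_(ord_max)%MM :> 'X_{1..n.+1}.
Proof.
apply/mnmP => j; rewrite !mnmE; case: unliftP => [l|] -> /=.
  by rewrite mnmE (negbTE (neq_lift _ _)).
by rewrite eqxx.
Qed.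

Lemma mon_zt_eq a b j k : (mon_zt a j == mon_zt b k) = (a == b) && (j == k).
Proof.
apply/eqP/andP => [E|[/eqP-> /eqP->]] //.
split; first by rewrite -(zpart_mon_zt a j) E zpart_mon_zt.
by rewrite -(mon_zt_max a j) E mon_zt_max.
Qed.

Lemma mdeg_mon_zt a k : mdeg (mon_zt a k) = (mdeg a + k)%N.
Proof.
rewrite !mdegE (bigD1_ord ord_max) //= mon_zt_max addnC; congr (_ + _)%N.
by apply: eq_bigr => i _; rewrite mon_zt_lift.
Qed.

Lemma tcoefE k f a : tcoef k f a = f (mon_zt a k). Proof. by []. Qed.

Lemma tcoefP f g : (forall k, tcoef k f = tcoef k g) -> f = g.
Proof.
move=> fg; apply: fpsP => m; have [a [k ->]] := mon_ztP m.
by rewrite -!tcoefE fg.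
Qed.

Lemma lin_cont_tcoef k : lin_cont k (@tcoef n R k).
Proof.
split=> [c f g|d f g fg a lt_a]; first by apply: fpsP.
by rewrite !tcoefE fg // mdeg_mon_zt ltn_add2r.
Qed.

Lemma tcoefB k f g : tcoef k (f - g) = tcoef k f - tcoef k g.
Proof. by apply: fpsP. Qed.

Lemma tcoef_sum k I (r : seq I) (A : pred I) (F : I -> fps n.+1 R) :
  tcoef k (\sum_(i <- r | A i) F i) = \sum_(i <- r | A i) tcoef k (F i).
Proof. by apply: (big_morph (tcoef k)) => [f g|]; apply: fpsP. Qed.

Lemma tcoef_mono k K :
  tcoef k (fmono R K) = if K ord_max == k then fmono R (zpart K) else 0.
Proof.
apply: fpsP => a.
rewrite tcoefE /= -{1}[K]mon_zt_zpart mon_zt_eq [k == _]eq_sym.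
by case: (_ == k); rewrite ?andbT ?andbF.
Qed.

Lemma zpartD K J : zpart (K + J) = (zpart K + zpart J)%MM.
Proof. by apply/mnmP => i; rewrite !mnmE. Qed.

(** Density in both factors reduces this to two monomials, for which at most one index, the
    t-exponent of one of them, gives a nonzero term. *)
Lemma tcoefM k f g :
  tcoef k (f * g) = \sum_(i < k.+1) tcoef i f * tcoef (k - i) g.
Proof.
have lc (h : fps n.+1 R) : lin_cont k (fun f => tcoef k (f * h)).
  rewrite -[k in lin_cont k]addn0.
  exact: lin_cont_comp (lin_cont_mulr h (@lin_cont_id _ _)) (lin_cont_tcoef k).
have lcr (G : 'I_k.+1 -> fps n R) :
    lin_cont k (fun f => \sum_(i < k.+1) tcoef i f * G i).
  apply: lin_cont_sum => i; apply: lin_cont_mulr.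
  by apply: lin_cont_weaken (lin_cont_tcoef i); rewrite -ltnS.
move: f; apply: (lin_cont_ext (lc g) (lcr _)) => K.
(* Reversing the sum puts [g] in the position that [lcr] handles. *)
have -> : \sum_(i < k.+1) tcoef i (fmono R K) * tcoef (k - i) g =
          \sum_(i < k.+1) tcoef i g * tcoef (k - i) (fmono R K).
  rewrite (reindex_inj rev_ord_inj) /=; apply: eq_bigr => i _.
  by rewrite subSS subKn -1?ltnS // mulrC.
rewrite mulrC; move: g; apply: (lin_cont_ext (lc _) (lcr _)) => J.
rewrite -fmonoD tcoef_mono mnmDE zpartD fmonoD.
have [eqk|neqk] := eqVneq.
  have lt_J : (J ord_max < k.+1)%N by rewrite -eqk ltnS leq_addr.
  have KJ : (k - J ord_max)%N = K ord_max by rewrite -eqk addKn.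
  rewrite (bigD1 (Ordinal lt_J)) //= !tcoef_mono KJ !eqxx.
  rewrite big1 ?addr0 // => i; rewrite -val_eqE /= eq_sym => /negbTE ne.
  by rewrite tcoef_mono ne mul0r.
rewrite big1 // => i _; rewrite !tcoef_mono.
case: eqP => [Ji|]; last by rewrite mul0r.
case: eqP => [Ki|]; last by rewrite mulr0.
by case/eqP: neqk; rewrite Ji Ki subnKC // -ltnS.
Qed.

Lemma tcoef_zderiv k i f :
  tcoef k (fderiv (lift ord_max i) f) = fderiv i (tcoef k f).
Proof.
by apply: fpsP => a; rewrite /= mon_zt_lift -mon_ztU -mon_ztD addn0.
Qed.

Lemma tcoef_tderiv k f : tcoef k (fderiv ord_max f) = tcoef k.+1 f *+ k.+1.
Proof.
apply: fpsP => a.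
by rewrite fpsMnE /= mon_zt_max -mon_zt01 -mon_ztD addn1 addm0.
Qed.

Lemma tcoef_inj_z k (f : fps n R) :
  tcoef k (inj_z f) = if k == 0%N then f else 0.
Proof.
by apply: fpsP => a; rewrite /= mon_zt_max; case: eqP; rewrite ?zpart_mon_zt.
Qed.

Lemma zvarE i : zvar i = inj_z (fvar R i) :> fps n.+1 R.
Proof.
apply: tcoefP => k; apply: fpsP => a; rewrite tcoef_inj_z tcoefE /=.
by rewrite -mon_ztU mon_zt_eq; case: (k == 0%N); rewrite ?andbT ?andbF.
Qed.

Lemma tvar_exp j : tvar ^+ j = fmono R (mon_zt 0%MM j : 'X_{1..n.+1}).
Proof.
elim: j => [|j IH]; first by rewrite mon_zt0 fmono0.
by rewrite exprS IH /tvar fvarE -mon_zt01 -fmonoD -mon_ztD addm0.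
Qed.

Lemma tcoef_tvarM k f :
  tcoef k (tvar * f) = if k is k'.+1 then tcoef k' f else 0.
Proof.
rewrite -[tvar]expr1 tvar_exp; apply: fpsP => a; rewrite tcoefE.
case: k => [|k]; last first.
  have -> : mon_zt a k.+1 = (mon_zt 0%MM 1 + mon_zt a k)%MM.
    by rewrite -mon_ztD add0m.
  by rewrite fmonoMl.
rewrite fmonoMl_out //; apply/mnm_lepP => /(_ ord_max).
by rewrite !mon_zt_max.
Qed.

Lemma tvarM_inj : injective ( *%R (tvar : fps n.+1 R)).
Proof.
by move=> f g /= fg; apply: tcoefP => k; have := congr1 (tcoef k.+1) fg;
  rewrite !tcoef_tvarM.
Qed.

Lemma tvar_exp_inj_z j (f : fps n R) m :
  (tvar ^+ j * inj_z f) m = if m ord_max == j then f (zpart m) else 0.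
Proof.
have [a [k ->]] := mon_ztP m; rewrite mon_zt_max zpart_mon_zt -tcoefE.
elim: j k => [|j IH] [|k].
- by rewrite mul1r tcoef_inj_z.
- by rewrite mul1r tcoef_inj_z.
- by rewrite exprS -mulrA tcoef_tvarM.
by rewrite exprS -mulrA tcoef_tvarM IH.
Qed.

End TSeries.

(** Seen as a substitution, the embedding falls under [fsubst_comp]. *)
Lemma inj_zE n (R : comNzRingType) (f : fps n R) : inj_z f = fsubst f zvar.
Proof.
have lcz : lin_cont 0 (@inj_z n R).
  split=> [a u v|d u v uv m lt_m].
    by apply: fpsP => m /=; case: eqP; rewrite ?mulr0 ?addr0.
  rewrite /=; case: eqP => // m0; apply: uv.
  by move: lt_m; rewrite -{1}(mon_zt_zpart m) mdeg_mon_zt m0 !addn0.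
have v0 i : (zvar i : fps n.+1 R) 0%MM = 0 by rewrite /= eq_sym mnm1_eq0.
apply: (lin_cont_ext lcz (lin_cont_fsubst _)) => k; rewrite fsubst_mono //.
have -> : inj_z (fmono R k) = fmono R (mon_zt k 0).
  apply: tcoefP => j; rewrite tcoef_inj_z tcoef_mono mon_zt_max zpart_mon_zt.
  by rewrite eq_sym.
elim/mnm_ind: k => [|i k IH]; first by rewrite gmono0 mon_zt0 fmono0.
by rewrite gmonoD gmonoU -IH -[0%N]addn0 mon_ztD fmonoD mon_ztU -fvarE.
Qed.

(** * The Burgers equation and the recursion for the coefficients in t *)

Section Burgers.
Variables (n : nat) (K : numDomainType) (P : fps n K) (Qt : fps n.+1 K).
Hypothesis hQt : zord_ge 2 Qt.

Let Gz i := zvar i + tvar * zgrad Qt i.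
Let Fz i := zvar i - tvar * inj_z (grad P i).
(** Completes the images of the z_i by sending t to itself, which turns [zsubst] into an ordinary
    substitution in n + 1 variables. *)
Let ext (X : 'I_n -> fps n.+1 K) j := oapp X tvar (unlift ord_max j).

Hypothesis hinv : zformal_inverse Gz Fz.

Let tvarM0 (f : fps n.+1 K) : (tvar * f) 0%MM = 0.
Proof. by rewrite -mon_zt0 -tcoefE tcoef_tvarM. Qed.

Let zvar0 i : (zvar i : fps n.+1 K) 0%MM = 0.
Proof. by rewrite /= eq_sym mnm1_eq0. Qed.

Let tvar0 : (tvar : fps n.+1 K) 0%MM = 0.
Proof. by rewrite -[tvar]mulr1 tvarM0. Qed.

Let extG0 j : ext Gz j 0%MM = 0.
Proof.
rewrite /ext; case: unlift => [i|]; last exact: tvar0.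
by rewrite [oapp _ _ _]/= fpsDE zvar0 tvarM0 addr0.
Qed.

Let extF0 j : ext Fz j 0%MM = 0.
Proof.
rewrite /ext; case: unlift => [i|]; last exact: tvar0.
by rewrite [oapp _ _ _]/= fpsBE zvar0 tvarM0 subr0.
Qed.

Let ext_max X : ext X ord_max = tvar. Proof. by rewrite /ext unlift_none. Qed.
Let ext_lift X i : ext X (lift ord_max i) = X i.
Proof. by rewrite /ext liftK. Qed.

(** In (z + t grad Q_t) o F = z the terms z cancel, and multiplication by t is injective. *)
Lemma zgrad_at_F i : fsubst (zgrad Qt i) (ext Fz) = inj_z (grad P i).
Proof.
have [/= + _] := hinv i; rewrite /zsubst -/(ext Fz) fsubstD fsubstM //.
rewrite !fsubst_var // ext_max ext_lift /Fz -addrA => /(canRL (addKr _)).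
by rewrite addNr addrC => /eqP; rewrite subr_eq0 => /eqP/tvarM_inj.
Qed.

(** The other composition, F o G = z, treated in the same way. Here one substitutes only into
    [grad P], which is free of t; this is the form that can be carried over to t = 1. *)
Lemma zgrad_fixpoint i : zgrad Qt i = fsubst (grad P i) Gz.
Proof.
transitivity (fsubst (inj_z (grad P i)) (ext Gz)); last first.
  rewrite inj_zE fsubst_comp //; apply: eq_fsubst => j.
  by rewrite fsubst_var // ext_lift.
have [_ /=] := hinv i; rewrite /zsubst -/(ext Gz) fsubstB fsubstM //.
rewrite !fsubst_var // ext_max ext_lift /Gz -addrA => /(canRL (addKr _)).
by rewrite addNr => /eqP; rewrite subr_eq0 => /eqP/tvarM_inj.
Qed.

(** Put u = grad Q_t. The t-derivative of u_i o F = d_i P is (d_t u_i) o F + sum_j (d_j u_i) o F *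
    d_t F_j = 0, where d_t F_j = - d_j P = - u_j o F. This is the claim composed with F. *)
Lemma burgers i : fderiv ord_max (zgrad Qt i) =
  \sum_j fderiv (lift ord_max j) (zgrad Qt i) * zgrad Qt j.
Proof.
have FG j : fsubst (ext Fz j) (ext Gz) = fvar K j.
  have [l ->|->] := unliftP ord_max j.
    by rewrite ext_lift; case: (hinv l).
  by rewrite ext_max fsubst_var.
(* Composition with F can be undone by composition with G. *)
have backK (f : fps n.+1 K) : fsubst (fsubst f (ext Fz)) (ext Gz) = f.
  by rewrite fsubst_comp // (eq_fsubst _ FG) fsubst_id.
apply/eqP; rewrite -subr_eq0; apply/eqP.
rewrite -[LHS]backK -[RHS](fsubst0 (ext Gz)); congr fsubst.
have tinj f : fderiv ord_max (inj_z f) = 0 :> fps n.+1 K.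
  by apply: tcoefP => k; rewrite tcoef_tderiv tcoef_inj_z mul0rn; apply: fpsP.
have := congr1 (fderiv ord_max) (zgrad_at_F i).
rewrite fsubst_chain // tinj (bigD1_ord ord_max) //=.
rewrite ext_max fderiv_var eqxx mulr1.
move/eqP; rewrite addr_eq0 fsubstB => /eqP->; apply/eqP.
rewrite -opprD oppr_eq0 addr_eq0; apply/eqP.
rewrite (big_morph (fun f => fsubst f (ext Fz)) (fsubstD _) (fsubst0 _)).
rewrite -sumrN; apply: eq_bigr => j _; rewrite fsubstM // -mulrN; congr (_ * _).
rewrite ext_lift /Fz fderivB zvarE fderivM !tinj mulr0 addr0 sub0r.
by rewrite fderiv_var eqxx mul1r zgrad_at_F.
Qed.

(** At t = 0 the map F is the identity, so composing with F does not change the coefficient of t^0,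
    and [zgrad_at_F] gives equal gradients. *)
Lemma tcoef0_Qt : P 0%MM = 0 -> tcoef 0 Qt = P.
Proof.
move=> P0; apply: fps_grad_inj => [i|]; last first.
  rewrite P0; have [//|/hQt] := eqVneq (tcoef 0 Qt 0%MM) 0.
  by rewrite zpart_mon_zt mdeg0.
have := congr1 (tcoef 0) (zgrad_at_F i); rewrite tcoef_inj_z eqxx => E.
rewrite -[RHS]/(grad P i) -{}E.
rewrite -tcoef_zderiv -/(zgrad Qt i); move: (zgrad Qt i) => f; symmetry.
have lcF := lin_cont_comp (lin_cont_fsubst (ext Fz)) (lin_cont_tcoef n K 0).
have tcoef0M (u v : fps n.+1 K) : tcoef 0 (u * v) = tcoef 0 u * tcoef 0 v.
  by rewrite tcoefM big_ord_recl big_ord0 addr0.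
apply: (lin_cont_ext lcF (lin_cont_tcoef n K 0)) => /=.
elim/mnm_ind => [|j m IH]; first by rewrite fmono0 fsubst1.
rewrite fmonoD fsubstM // !tcoef0M IH -fvarE fsubst_var //.
congr (_ * _); have [l ->|->] := unliftP ord_max j; last by rewrite ext_max.
by rewrite ext_lift /Fz tcoefB tcoef_tvarM subr0.
Qed.

(** The i-th derivative of the claim is twice the coefficient of t^k in [burgers], by symmetry of
    second derivatives; both constant terms vanish because of the order of [Qt]. *)
Lemma tcoef_rec k : tcoef k.+1 Qt *+ (2 * k.+1) =
  \sum_(l < k.+1) dotp (grad (tcoef l Qt)) (grad (tcoef (k - l) Qt)).
Proof.
pose q l := tcoef l Qt.
have q0 l i : fderiv i (q l) 0%MM = 0.
  rewrite /= add0m -[X in X *+ _]/(Qt _).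
  have [->|/hQt] := eqVneq (Qt (mon_zt U_(i)%MM l)) 0; first by rewrite mul0rn.
  by rewrite zpart_mon_zt mdeg1.
apply: fps_grad_inj => [i|]; last first.
  rewrite fpsMnE fps_sumE big1 => [|l _]; last first.
    by rewrite /dotp fps_sumE big1 // => j _; rewrite fps_mul_coef0 !q0 mul0r.
  have [->|/hQt] := eqVneq (tcoef k.+1 Qt 0%MM) 0; first by rewrite mul0rn.
  by rewrite zpart_mon_zt mdeg0.
have /(congr1 (tcoef k)) := burgers i.
rewrite tcoef_tderiv tcoef_zderiv tcoef_sum => E.
pose S1 := \sum_(l < k.+1)
  \sum_j fderiv i (fderiv j (q l)) * fderiv j (q (k - l)%N).
have {}E : fderiv i (q k.+1) *+ k.+1 = S1.
  rewrite E /S1 exchange_big /=; apply: eq_bigr => j _; rewrite tcoefM.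
  by apply: eq_bigr => l _; rewrite !tcoef_zderiv fderivC.
have -> : fderiv i (tcoef k.+1 Qt *+ (2 * k.+1)) = S1 *+ 2.
  rewrite -E -mulrnA mulnC; apply: fpsP => m.
  by rewrite !fpsMnE /= fpsMnE mulrnAC.
(* Under l -> k - l one copy of [S1] becomes the other half of the Leibniz rule. *)
rewrite mulr2n fderiv_sum {2}/S1 (reindex_inj rev_ord_inj) /= /S1 -big_split /=.
apply: eq_bigr => l _; rewrite /dotp fderiv_sum -big_split /=.
apply: eq_bigr => j _; rewrite fderivM; congr (_ + _).
by rewrite subSS subKn -1?ltnS // mulrC.
Qed.

End Burgers.

(** * Specialization at t = 1 *)

Section Map.
Variables (n : nat) (A B : comNzRingType) (phi : {rmorphism A -> B}).
Implicit Types f g : fps n A.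

Definition fps_map p (f : fps p A) : fps p B := FPS (fun m => phi (f m)).

Lemma fps_mapD f g : fps_map (f + g) = fps_map f + fps_map g.
Proof. by apply: fpsP => m; rewrite /= rmorphD. Qed.

Lemma fps_mapM p (f g : fps p A) : fps_map (f * g) = fps_map f * fps_map g.
Proof.
apply: fpsP => m; rewrite /= rmorph_sum; apply: eq_bigr => k _.
by rewrite rmorphM.
Qed.

Lemma fps_map1 p : fps_map 1 = 1 :> fps p B.
Proof.
by apply: fpsP => m /=; case: eqP; rewrite ?rmorph1 ?rmorph0.
Qed.

Lemma fps_map_deriv i f : fps_map (fderiv i f) = fderiv i (fps_map f).
Proof. by apply: fpsP => m; rewrite /= rmorphMn. Qed.

Lemma fps_map_gmono p (g : 'I_n -> fps p A) k :
  fps_map (gmono g k) = gmono (fun i => fps_map (g i)) k.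
Proof.
elim/mnm_ind: k => [|i k IH]; first by rewrite !gmono0 fps_map1.
by rewrite !gmonoD !gmonoU fps_mapM IH.
Qed.

Lemma fps_map_fsubst p f (g : 'I_n -> fps p A) :
  fps_map (fsubst f g) = fsubst (fps_map f) (fun i => fps_map (g i)).
Proof.
apply: fpsP => m; rewrite /= rmorph_sum; apply: eq_bigr => k _.
rewrite rmorphM -[\prod_i _ ^+ _]/(gmono _ _) -[in RHS]/(gmono _ _).
by rewrite -fps_map_gmono.
Qed.

End Map.

Section Expands.
Variables (n : nat) (R : comNzRingType).

(* A member of R[t][[z]] seen inside R[[z,t]]. *)
Definition expands (q : fps n {poly R}) (Q : fps n.+1 R) :=
  forall a k, (q a)`_k = Q (mon_zt a k).

Lemma expands_inj q r Q : expands q Q -> expands r Q -> q = r.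
Proof. by move=> qQ rQ; apply: fpsP => a; apply/polyP => k; rewrite qQ rQ. Qed.

Lemma expandsD q r Q S : expands q Q -> expands r S -> expands (q + r) (Q + S).
Proof. by move=> qQ rS a k; rewrite !fpsDE coefD qQ rS. Qed.

Lemma expandsM q r Q S : expands q Q -> expands r S -> expands (q * r) (Q * S).
Proof.
move=> qQ rS a k; rewrite -tcoefE tcoefM fps_sumE coef_sum.
transitivity
  (\sum_(j : 'X_{1..n < (mdeg a).+1, (mdeg a).+1} | a == (j.1 + j.2)%MM)
   \sum_(i < k.+1) tcoef i Q j.1 * tcoef (k - i) S j.2); last first.
  by rewrite exchange_big.
by apply: eq_bigr => j _; rewrite coefM; apply: eq_bigr => i _; rewrite qQ rS.
Qed.

Lemma expands_inj_z (p : fps n R) : expands (fps_map polyC p) (inj_z p).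
Proof.
move=> a k; rewrite -tcoefE tcoef_inj_z /= coefC.
by case: eqP.
Qed.

Lemma expands_gmono (g : 'I_n -> fps n {poly R}) (G : 'I_n -> fps n.+1 R) k :
  (forall i, expands (g i) (G i)) -> expands (gmono g k) (gmono G k).
Proof.
move=> gG; elim/mnm_ind: k => [|i k IH]; last first.
  by rewrite !gmonoD !gmonoU; apply: expandsM.
rewrite !gmono0 => a k; rewrite !fps1E -mon_zt0 mon_zt_eq -polyC_natr coefC.
by case: (k == 0%N); rewrite ?andbT ?andbF.
Qed.

(** The coefficient in R[[z,t]] involves exponents up to degree [mdeg a + k], the one in R[t][[z]]
    only up to [mdeg a]; [fsubst_wide] brings both to the larger range. *)
Lemma expands_fsubst p (g : 'I_n -> fps n {poly R}) (G : 'I_n -> fps n.+1 R) :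
  (forall i, g i 0%MM = 0) -> (forall i, expands (g i) (G i)) ->
  expands (fsubst (fps_map polyC p) g) (fsubst p G).
Proof.
move=> g0 gG a k; rewrite (@fsubst_wide _ _ _ _ g0 (mdeg (mon_zt a k)).+1).
  rewrite coef_sum /= -[RHS]/(\sum_(j : 'X_{1..n < _}) p j * gmono G j _).
  by apply: eq_bigr => j _; rewrite coefCM (expands_gmono j gG).
by rewrite ltnS mdeg_mon_zt leq_addr.
Qed.

End Expands.

Section Specialization.
Variables (n : nat) (K : numDomainType) (P : fps n K) (Qt : fps n.+1 K).
Hypotheses (hP : ord_ge 2 P) (hQt : zord_ge 2 Qt).
Hypothesis hinv : zformal_inverse (fun i => zvar i + tvar * zgrad Qt i)
                                  (fun i => zvar i - tvar * inj_z (grad P i)).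
Variable N : 'X_{1..n} -> nat.
Hypothesis hN : forall a k, (N a <= k)%N -> tcoef k Qt a = 0.

Let q : fps n {poly K} := FPS (fun a => \poly_(k < N a) tcoef k Qt a).
Let S : fps n K := fps_map (horner_eval 1) q.

Let q_expands : expands q Qt.
Proof.
by move=> a k; rewrite /= coef_poly; case: ltnP => // /hN <-.
Qed.

Let dq_expands i : expands (fderiv i q) (zgrad Qt i).
Proof.
move=> a k; rewrite -tcoefE tcoef_zderiv [LHS]/=.
by rewrite -[\poly_(_ < _) _]/(q _) coefMn q_expands.
Qed.

Let dq0 i : fderiv i q 0%MM = 0.
Proof.
apply/polyP => k; rewrite dq_expands coef0 -tcoefE tcoef_zderiv /= add0m.
have [->|/hQt] := eqVneq (Qt (mon_zt U_(i)%MM k)) 0; first by rewrite mul0rn.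
by rewrite zpart_mon_zt mdeg1.
Qed.

(** The equation of [zgrad_fixpoint] is lifted to K[t][[z]], where evaluation at 1 is a ring
    morphism on coefficients and so commutes with derivatives and substitution. *)
Lemma specialization_fixpoint i :
  fderiv i S = fsubst (grad P i) (fun j => fvar K j + fderiv j S).
Proof.
(* This is z + t grad Q_t, with t as the constant ['X]. *)
pose g j := fps_map polyC (fvar K j) + fpsC n 'X * fderiv j q.
have g0 j : g j 0%MM = 0.
  by rewrite fpsDE fps_mul_coef0 dq0 mulr0 addr0 /= eq_sym mnm1_eq0.
have gG j : expands (g j) (zvar j + tvar * zgrad Qt j).
  apply: expandsD; first by rewrite zvarE; apply: expands_inj_z.
  apply: expandsM => // a k; rewrite /= -mon_zt01 mon_zt_eq.
  by case: (a == _); rewrite ?coefX ?coef0 //=; case: (k == _).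
have E : fderiv i q = fsubst (fps_map polyC (grad P i)) g.
  apply: (expands_inj (dq_expands i)); rewrite (zgrad_fixpoint hinv).
  exact: expands_fsubst.
have evC (f : fps n K) : fps_map (horner_eval 1) (fps_map polyC f) = f.
  by apply: fpsP => m; rewrite /= horner_evalE hornerC.
rewrite -fps_map_deriv E fps_map_fsubst evC; apply: eq_fsubst => j.
rewrite fps_mapD fps_mapM evC fps_map_deriv; congr (_ + _).
rewrite -[RHS]mul1r; congr (_ * _); apply: fpsP => m /=.
by case: eqP; rewrite horner_evalE ?hornerX ?horner0.
Qed.

(** The fixpoint equation makes z + grad S a right inverse of z - grad P, of which z + grad Q is a
    left inverse; hence the two gradients agree. *)
Lemma inverse_specialization (Q : fps n K) : ord_ge 2 Q ->
  formal_inverse (fun i => fvar K i + grad Q i)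
                 (fun i => fvar K i - grad P i) ->
  forall a, Q a = \sum_(k < N a) tcoef k Qt a.
Proof.
move=> hQ hQinv.
have grad0 (f : fps n K) i : ord_ge 2 f -> grad f i 0%MM = 0.
  move=> hf; rewrite /grad /= add0m.
  by have [->|/hf] := eqVneq (f U_(i)%MM) 0; rewrite ?mul0rn ?mdeg1.
have v0 i : fvar K i 0%MM = 0 :> K by rewrite /= eq_sym mnm1_eq0.
pose H i := fvar K i + fderiv i S.
have H0 i : H i 0%MM = 0.
  rewrite fpsDE v0 add0r -fps_map_deriv -[LHS]/((fderiv i q 0%MM).[1]).
  by rewrite dq0 horner0.
have F0 i : (fvar K i - grad P i) 0%MM = 0 by rewrite fpsBE v0 grad0 ?subr0.
have FH i : fsubst (fvar K i - grad P i) H = fvar K i.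
  by rewrite fsubstB fsubst_var // -specialization_fixpoint /H addrK.
have QS : Q = S.
  apply: fps_grad_inj => [i|].
    have [/= E _] := hQinv i; have := fsubst_comp (fvar K i + grad Q i) F0 H0.
    rewrite E fsubst_var // (eq_fsubst _ FH) fsubst_id /H.
    by move/addrI.
  have -> : Q 0%MM = 0 by have [//|/hQ] := eqVneq (Q 0%MM) 0; rewrite mdeg0.
  rewrite /S /= horner_evalE horner_poly big1 // => k _; rewrite expr1n mulr1.
  have [//|/hQt] := eqVneq (tcoef k Qt 0%MM) 0.
  by rewrite zpart_mon_zt mdeg0.
move=> a; rewrite QS /S /= horner_evalE horner_poly.
by apply: eq_bigr => k _; rewrite expr1n mulr1.
Qed.

End Specialization.

(** * Binary trees up to isomorphism *)

Definition pchild (v w : seq nat) := prefix v w && (size w == (size v).+1).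

(** The anonymous inner recursion of [pverts], named to allow induction on it. *)
Fixpoint pforest i (Ts : seq ptree) : seq (seq nat) :=
  if Ts is T :: Ts' then map (cons i) (pverts T) ++ pforest i.+1 Ts' else [::].

Lemma pvertsE Ts : pverts (Bplus Ts) = [::] :: pforest 0 Ts.
Proof. by []. Qed.

Lemma ptree_nested_ind (Q : ptree -> Prop) :
  (forall Ts, foldr (fun T => and (Q T)) True Ts -> Q (Bplus Ts)) ->
  forall T, Q T.
Proof.
move=> H; fix IH 1; case=> Ts; apply: H.
by elim: Ts => //= T Ts IHTs; exact: (conj (IH T) IHTs).
Qed.

Lemma pforestP i Ts x : x \in pforest i Ts ->
  exists2 k, (i <= k)%N & exists y, x = k :: y.
Proof.
elim: Ts i => //= T Ts IH i; rewrite mem_cat => /orP[/mapP[y _ ->]|/IH].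
  by exists i => //; exists y.
by case=> k /ltnW le_ik [y ->]; exists k => //; exists y.
Qed.

Lemma pverts_uniq T : uniq (pverts T).
Proof.
elim/ptree_nested_ind: T => Ts IH; rewrite pvertsE /=; apply/andP; split.
  by apply/negP => /pforestP[k _ []].
elim: Ts 0%N IH => //= T Ts IHTs i [uT uTs].
rewrite cat_uniq map_inj_uniq ?uT //=; last by move=> ? ? [].
rewrite IHTs // andbT; apply/hasPn => x /pforestP[k lt_ik [y ->]].
by apply/negP => /mapP[z _ [Ek _]]; rewrite Ek ltnn in lt_ik.
Qed.

Lemma verts_uniq T : uniq (verts T).
Proof. by case: T => //= T; apply: pverts_uniq. Qed.

(** Turns cardinals over the vertex type into counts over a list of paths, which follow the
    recursion on trees. *)
Lemma card_seq_sub_count (s : seq (seq nat)) (Q : pred (seq nat)) :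
  uniq s -> #|[set v : seq_sub s | Q (val v)]| = count Q s.
Proof.
move=> us; rewrite cardsE cardE -[in RHS](val_seq_sub_enum us) count_map.
by rewrite /enum_mem size_filter unlock; apply: eq_count => v; rewrite !inE.
Qed.

Lemma nvertsE T : nverts T = size (verts T).
Proof. exact/card_seq_sub/verts_uniq. Qed.

Lemma is_leafE T (v : vertex T) :
  is_leaf v = ~~ has (pchild (val v)) (verts T).
Proof.
apply/forallP/hasPn => [H w wT|H w]; last exact/H/valP.
exact: (H (SeqSub wT)).
Qed.

Lemma nleavesE T :
  nleaves T = count (fun v => ~~ has (pchild v) (verts T)) (verts T).
Proof.
rewrite -(card_seq_sub_count _ (verts_uniq T)); apply: eq_card => v.
by rewrite !inE is_leafE.
Qed.

Lemma is_binaryE T : is_binary T =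
  all (fun v => (count (pchild v) (verts T) == 0%N) ||
                (count (pchild v) (verts T) == 2)) (verts T).
Proof.
have E (v : vertex T) : is_leaf v || (#|[set w | child v w]| == 2%N) =
    (count (pchild (val v)) (verts T) == 0%N) ||
    (count (pchild (val v)) (verts T) == 2).
  have C : #|[set w | child v w]| = count (pchild (val v)) (verts T).
    exact: (card_seq_sub_count _ (verts_uniq T)).
  by rewrite is_leafE has_count -eqn0Ngt C.
apply/forallP/allP => [H v vT|H v]; last by rewrite E; apply/H/valP.
by have := H (SeqSub vT); rewrite E.
Qed.

Lemma count_pchild_root i Ts : count (pchild [::]) (pforest i Ts) = size Ts.
Proof.
elim: Ts i => //= -[Ts'] Ts IH i; rewrite count_cat IH count_map pvertsE /=.
rewrite [X in (_ + X + _)%N](_ : _ = 0%N) ?addn0 //.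
apply/eqP; rewrite -leqn0 leqNgt -has_count; apply/hasPn => x.
by case/pforestP => k _ [y ->].
Qed.

Lemma count_pchild_map i j v s :
  count (pchild (i :: v)) (map (cons j) s) =
  if i == j then count (pchild v) s else 0%N.
Proof.
rewrite count_map; case: eqP => [->|ne].
  by apply: eq_count => w; rewrite /pchild /= eqxx.
rewrite -(count_pred0 s); apply: eq_count => w.
by rewrite /pchild /=; case: eqP.
Qed.

(* Planar: the children of a node are ordered. *)
Inductive bintree := Leaf | Node of bintree & bintree.

HB.instance Definition _ := gen_eqMixin bintree.

Fixpoint ptree_of p :=
  if p is Node a b then Bplus [:: ptree_of a; ptree_of b] else Bplus [::].

Fixpoint bleaves p := if p is Node a b then (bleaves a + bleaves b)%N else 1%N.

Lemma bleaves_gt0 p : (0 < bleaves p)%N.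
Proof. by elim: p => //= a Ha b _; rewrite addn_gt0 Ha. Qed.

Lemma pverts_ptree_of a b : pverts (ptree_of (Node a b)) =
  [::] :: map (cons 0%N) (pverts (ptree_of a)) ++
          map (cons 1%N) (pverts (ptree_of b)).
Proof. by rewrite pvertsE /= cats0. Qed.

Lemma count_child_node T1 T2 v :
  let s := pverts (Bplus [:: T1; T2]) in
  [/\ count (pchild (0%N :: v)) s = count (pchild v) (pverts T1),
      count (pchild (1%N :: v)) s = count (pchild v) (pverts T2) &
      count (pchild [::]) s = 2].
Proof.
rewrite pvertsE; split; last exact: (count_pchild_root 0 [:: T1; T2]);
  by rewrite /= !count_cat !count_pchild_map ?addn0 ?add0n.
Qed.

Lemma nverts_ptree_of p : nverts (Some (ptree_of p)) = (2 * bleaves p - 1)%N.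
Proof.
rewrite nvertsE /=; elim: p => // a IHa b IHb.
rewrite pverts_ptree_of /= size_cat !size_map IHa IHb.
by have := bleaves_gt0 a; have := bleaves_gt0 b; lia.
Qed.

Lemma nleaves_ptree_of p : nleaves (Some (ptree_of p)) = bleaves p.
Proof.
rewrite nleavesE; elim: p => // a IHa b IHb.
move: (@count_child_node (ptree_of a) (ptree_of b)) (pverts_ptree_of a b).
rewrite -[verts _]/(pverts (ptree_of (Node a b))) -/(ptree_of (Node a b)).
move: (pverts (ptree_of (Node a b))) => s H Es.
rewrite [X in count _ X]Es /= count_cat !count_map.
rewrite has_count; have [_ _ ->] := H [::]; rewrite add0n -IHa -IHb.
by congr (_ + _)%N; apply: eq_count => v /=; rewrite !has_count;
  have [E1 E2 _] := H v; rewrite ?E1 ?E2.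
Qed.

Lemma binary_node T1 T2 : is_binary (Some (Bplus [:: T1; T2])) =
  is_binary (Some T1) && is_binary (Some T2).
Proof.
move: (@count_child_node T1 T2) (pvertsE [:: T1; T2]); rewrite !is_binaryE.
rewrite -[verts (Some (Bplus _))]/(pverts (Bplus [:: T1; T2])).
move: (pverts (Bplus [:: T1; T2])) => s H Es.
rewrite [X in all _ X]Es /= cats0 all_cat !all_map.
have [_ _ ->] := H [::]; rewrite [LHS]/=.
by congr andb; apply: eq_all => v /=; have [E1 E2 _] := H v; rewrite ?E1 ?E2.
Qed.

Lemma binary_ptree_of p : is_binary (Some (ptree_of p)).
Proof.
elim: p => [|a IHa b IHb]; last by rewrite binary_node IHa IHb.
by rewrite is_binaryE.
Qed.

Lemma binaryP T : is_binary (Some T) -> exists p, T = ptree_of p.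
Proof.
elim/ptree_nested_ind: T => Ts IH bTs.
have : (size Ts == 0%N) || (size Ts == 2).
  have := bTs; rewrite is_binaryE => /allP/(_ [::]).
  by rewrite /= in_cons eqxx => /(_ isT); rewrite count_pchild_root.
case: Ts => [|T1 [|T2 [|]]] // in IH bTs *; first by exists Leaf.
move: bTs; rewrite binary_node => /andP[b1 b2].
case: IH => /(_ b1)[p ->] [/(_ b2)[q ->] _].
by exists (Node p q).
Qed.

(* [tfact] of the tree without its leaves: what remains of [p] has            *)
(* [bleaves p - 1] vertices.                                                  *)
Fixpoint prune_fact p :=
  if p is Node a b then ((bleaves p).-1 * (prune_fact a * prune_fact b))%N
  else 1%N.

Lemma prune_fact_gt0 p : (0 < prune_fact p)%N.
Proof.
elim: p => //= a Ha b Hb; rewrite !muln_gt0 Ha Hb !andbT.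
by have := bleaves_gt0 a; have := bleaves_gt0 b; lia.
Qed.

Lemma size_verts_prune p :
  size (verts (prune (Some (ptree_of p)))) = (bleaves p).-1.
Proof.
elim: p => // a IHa b IHb; rewrite /= in IHa IHb *.
case: (pprune (ptree_of a)) IHa => [Ta|] /=;
case: (pprune (ptree_of b)) IHb => [Tb|] /=;
rewrite ?size_cat ?size_map /=;
by have := bleaves_gt0 a; have := bleaves_gt0 b; lia.
Qed.

Lemma tfact_prune p : tfact (prune (Some (ptree_of p))) = prune_fact p.
Proof.
elim: p => // a IHa b IHb.
have := size_verts_prune (Node a b); rewrite -nvertsE.
rewrite /= in IHa IHb *; rewrite -IHa -IHb => <-; congr muln.
case: (pprune (ptree_of a)) => [Ta|] /=;
case: (pprune (ptree_of b)) => [Tb|] /=;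
by rewrite ?big_cons big_nil ?muln1 ?mul1n.
Qed.

(** * Isomorphisms between planar binary trees and their number *)

(** A structural copy of the vertex type: the vertices of a node split by case analysis rather than
    by comparing paths. *)
Fixpoint vert p : finType :=
  if p is Node a b then option (vert a + vert b)%type else unit.

Definition vroot p : vert p := if p is Node a b then None else tt.

Fixpoint vpath p : vert p -> seq nat :=
  match p with
  | Leaf => fun _ => [::]
  | Node a b => fun v => match v with
      | None => [::]
      | Some (inl u) => 0%N :: vpath u
      | Some (inr u) => 1%N :: vpath u
      end
  end.

Lemma vpath_inj p : injective (@vpath p).
Proof.
elim: p => [|a IHa b IHb] /=; first by case=> -[].
by move=> [[u|u]|] [[v|v]|] //= [] => [/IHa|/IHb] ->.
Qed.

Lemma vpathP p x :
  reflect (exists v : vert p, vpath v = x) (x \in pverts (ptree_of p)).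
Proof.
elim: p x => [|a IHa b IHb] x.
  rewrite /= inE; apply: (iffP eqP) => [->|[]//]; by exists tt.
rewrite pverts_ptree_of inE mem_cat.
apply: (iffP or3P) => [[/eqP->|/mapP|/mapP]|].
- by exists None.
- by case=> _ /IHa[v <-] ->; exists (Some (inl v)).
- by case=> _ /IHb[v <-] ->; exists (Some (inr v)).
case=> -[[v|v]|] <- /=; [apply: Or32|apply: Or33|exact: Or31].
  by apply/map_f/IHa; exists v.
by apply/map_f/IHb; exists v.
Qed.

Lemma vpath_root p (v : vert p) : (vpath v == [::]) = (v == vroot p).
Proof. by case: p v => [|a b] [] //; case. Qed.

Definition vchild p : rel (vert p) := fun v w => pchild (vpath v) (vpath w).

Lemma vchild_ll a b (v w : vert a) :
  @vchild (Node a b) (Some (inl v)) (Some (inl w)) = vchild v w.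
Proof. by rewrite /vchild /pchild /= eqSS. Qed.

Lemma vchild_rr a b (v w : vert b) :
  @vchild (Node a b) (Some (inr v)) (Some (inr w)) = vchild v w.
Proof. by rewrite /vchild /pchild /= eqSS. Qed.

Lemma vchild_to_root p (v : vert p) : vchild v (vroot p) = false.
Proof.
have /eqP E : vpath (vroot p) == [::] by rewrite vpath_root.
by rewrite /vchild /pchild E andbF.
Qed.

Lemma vchild_nl a b (v : vert a) :
  @vchild (Node a b) None (Some (inl v)) = (v == vroot a).
Proof. by rewrite /vchild /pchild /= eqSS size_eq0 vpath_root. Qed.

Lemma vchild_nr a b (v : vert b) :
  @vchild (Node a b) None (Some (inr v)) = (v == vroot b).
Proof. by rewrite /vchild /pchild /= eqSS size_eq0 vpath_root. Qed.

Lemma vparent p (v : vert p) : v != vroot p -> exists u, vchild u v.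
Proof.
elim: p v => [|a IHa b IHb] /= [] // [] v _.
  have [->|/IHa[u uv]] := eqVneq v (vroot a).
    by exists None; rewrite vchild_nl.
  by exists (Some (inl u)); rewrite vchild_ll.
have [->|/IHb[u uv]] := eqVneq v (vroot b).
  by exists None; rewrite vchild_nr.
by exists (Some (inr u)); rewrite vchild_rr.
Qed.

Lemma vchild_size p (v w : vert p) :
  vchild v w -> size (vpath w) = (size (vpath v)).+1.
Proof. by case/andP => _ /eqP. Qed.

Lemma vchild_ind p (Q : vert p -> Prop) :
  Q (vroot p) -> (forall u v, vchild u v -> Q u -> Q v) -> forall v, Q v.
Proof.
move=> Q0 QS v; have [d] := ubnP (size (vpath v)); elim: d => // d IH in v *.
have [->//|/vparent[u uv]] := eqVneq v (vroot p).
by rewrite (vchild_size uv) => lt; apply: (QS u) => //; apply: IH.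
Qed.

Lemma vparent_uniq p (u v w : vert p) : vchild u w -> vchild v w -> u = v.
Proof.
case/andP => /prefixP[x Ex] /eqP su /andP[/prefixP[y Ey] /eqP sv].
have [suv] : (size (vpath u)).+1 = (size (vpath v)).+1 by rewrite -su.
apply: vpath_inj; have := congr1 (take (size (vpath u))) (etrans (esym Ex) Ey).
by rewrite take_size_cat // suv take_size_cat.
Qed.

(** Stated with the child relation, which restricts well to subtrees; [viso_adjacent] recovers it
    from adjacency. *)
Definition viso p q (f : vert p -> vert q) :=
  [/\ injective f, forall y, exists x, f x = y, f (vroot p) = vroot q &
      forall x y, vchild (f x) (f y) = vchild x y].

Definition visos p q : {set {ffun vert p -> vert q}} :=
  [set f : {ffun vert p -> vert q} | `[< viso f >]].

Definition niso p q := #|visos p q|.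

Lemma visosP p q (f : {ffun vert p -> vert q}) :
  reflect (viso f) (f \in visos p q).
Proof. by rewrite inE; apply: asboolP. Qed.

Lemma niso_leaf : niso Leaf Leaf = 1%N.
Proof.
rewrite -(cards1 ([ffun=> tt] : {ffun vert Leaf -> vert Leaf})).
apply: eq_card => f.
rewrite !inE; have -> : f = [ffun=> tt].
  by apply/ffunP => x; rewrite ffunE; case: (f x).
rewrite eqxx; apply/asboolP; split=> //.
- by case=> -[].
- by case; exists tt; rewrite ffunE.
- by rewrite ffunE.
Qed.

Lemma niso_leaf_node a b : niso Leaf (Node a b) = 0%N.
Proof.
apply/eqP; rewrite cards_eq0; apply/eqP/finset.setP => f.
rewrite finset.in_set0.
apply/negP => /visosP[_ sf f0 _].
have [[]] := sf (Some (inl (vroot a))).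
by rewrite -[tt]/(vroot Leaf) f0.
Qed.

Lemma niso_node_leaf a b : niso (Node a b) Leaf = 0%N.
Proof.
apply/eqP; rewrite cards_eq0; apply/eqP/finset.setP => f.
rewrite finset.in_set0.
apply/negP => /visosP[injf _ _ _].
have /injf // : f None = f (Some (inl (vroot a))).
by case: (f None); case: (f _).
Qed.

Definition vglue a b c d
    (f : {ffun vert a -> vert c} * {ffun vert b -> vert d}) :
    {ffun vert (Node a b) -> vert (Node c d)} :=
  [ffun x : vert (Node a b) => match x return vert (Node c d) with
     | None => None
     | Some (inl v) => Some (inl (f.1 v))
     | Some (inr v) => Some (inr (f.2 v))
   end].

Lemma vglue_inj a b c d : injective (@vglue a b c d).
Proof.
move=> [f1 f2] [g1 g2] /ffunP E; congr pair; apply/ffunP => v.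
  by have := E (Some (inl v)); rewrite !ffunE => -[].
by have := E (Some (inr v)); rewrite !ffunE => -[].
Qed.

(** The image of the left child decides where the whole left subtree goes. *)
Definition straight a b c d : {set {ffun vert (Node a b) -> vert (Node c d)}} :=
  [set f in visos (Node a b) (Node c d)
         | f (Some (inl (vroot a))) == Some (inl (vroot c))].

Lemma viso_vglue a b c d f1 f2 :
  viso (vglue (f1, f2) : vert (Node a b) -> vert (Node c d)) <->
  viso f1 /\ viso f2.
Proof.
set g := vglue _.
have gn : g None = None by rewrite ffunE.
have gl v : g (Some (inl v)) = Some (inl (f1 v)) by rewrite ffunE.
have gr v : g (Some (inr v)) = Some (inr (f2 v)) by rewrite ffunE.
split=> [[gi gs _ gc]|[[i1 s1 r1 c1] [i2 s2 r2 c2]]].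
  split; split.
  - by move=> x y E; have /gi[] : g (Some (inl x)) = g (Some (inl y))
      by rewrite !gl E.
  - move=> y; have [[[x|x]|]] := gs (Some (inl y)); rewrite ?gl ?gr ?gn //.
    by case=> <-; exists x.
  - apply/eqP; rewrite -(vchild_nl d) -gl -gn gc vchild_nl //.
  - by move=> x y; rewrite -(vchild_ll d) -!gl gc vchild_ll.
  - by move=> x y E; have /gi[] : g (Some (inr x)) = g (Some (inr y))
      by rewrite !gr E.
  - move=> y; have [[[x|x]|]] := gs (Some (inr y)); rewrite ?gl ?gr ?gn //.
    by case=> <-; exists x.
  - by apply/eqP; rewrite -(vchild_nr c) -gr -gn gc vchild_nr.
  - by move=> x y; rewrite -(vchild_rr c) -!gr gc vchild_rr.
split=> //.
- move=> [[x|x]|] [[y|y]|]; rewrite ?gl ?gr ?gn // => -[]; first by move/i1->.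
  by move/i2->.
- case=> [[y|y]|].
  + by have [x <-] := s1 y; exists (Some (inl x)).
  + by have [x <-] := s2 y; exists (Some (inr x)).
  + by exists None.
- move=> [[x|x]|] [[y|y]|]; rewrite ?gl ?gr ?gn //.
  + by rewrite !vchild_ll c1.
  + by rewrite !vchild_rr c2.
  + by rewrite !vchild_nl -r1 (inj_eq i1).
  + by rewrite !vchild_nr -r2 (inj_eq i2).
Qed.

(** [vglue] is a bijection from pairs of isomorphisms: descending along children keeps the left
    subtree on the left, and injectivity leaves only the right child of the target for the root of
    [b]. *)
Lemma card_straight a b c d : #|straight a b c d| = (niso a c * niso b d)%N.
Proof.
rewrite /niso -cardsX -(card_imset _ (@vglue_inj a b c d)).
apply: eq_card => f; rewrite inE; apply/andP/imsetP => [[/visosP fi /eqP fl]|].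
  have [injf sf f0 cf] := fi.
  have inlP v : exists w, f (Some (inl v)) = Some (inl w).
    elim/vchild_ind: v => [|u v uv [w Ew]]; first by exists (vroot c).
    move: uv; rewrite -(vchild_ll b) -cf Ew.
    by case: (f _) => [[y|y]|] //; exists y.
  have inrP v : exists w, f (Some (inr v)) = Some (inr w).
    elim/vchild_ind: v => [|u v uv [w Ew]].
      have := cf None (Some (inr (vroot b))); rewrite vchild_nr eqxx.
      rewrite [f None]f0; case E: (f (Some (inr _))) => [[y|y]|] //.
        by rewrite vchild_nl => /eqP y0; move: E; rewrite y0 -fl => /injf.
      by exists y.
    move: uv; rewrite -(vchild_rr a) -cf Ew.
    by case: (f _) => [[y|y]|] //; exists y.
  (* By [inlP] and [inrP] the default roots in [f1] and [f2] are never reached. *)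
  pose f1 := [ffun v =>
    if f (Some (inl v)) is Some (inl w) then w else vroot c].
  pose f2 := [ffun v =>
    if f (Some (inr v)) is Some (inr w) then w else vroot d].
  have Ef : f = vglue (f1, f2).
    apply/ffunP => -[[v|v]|]; rewrite !ffunE /=.
    - by have [w Ew] := inlP v; rewrite Ew.
    - by have [w Ew] := inrP v; rewrite Ew.
    - exact: f0.
  exists (f1, f2) => //; move: fi; rewrite Ef => /viso_vglue[h1 h2].
  by rewrite inE; apply/andP; split; apply/visosP.
case=> -[f1 f2]; rewrite inE => /andP[/visosP h1 /visosP h2] ->.
split; first by apply/visosP/viso_vglue.
by rewrite ffunE /=; have [_ _ -> _] := h1.
Qed.

Definition vswap c d (x : vert (Node c d)) : vert (Node d c) :=
  match x with
  | None => None
  | Some (inl v) => Some (inr v)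
  | Some (inr v) => Some (inl v)
  end.

Lemma vswapK c d : cancel (@vswap c d) (@vswap d c).
Proof. by case=> [[]|]. Qed.

Lemma vchild_swap c d (x y : vert (Node c d)) :
  vchild (vswap x) (vswap y) = vchild x y.
Proof.
case: x y => [[x|x]|] [[y|y]|] //=;
by rewrite ?(vchild_rr, vchild_ll, vchild_nr, vchild_nl).
Qed.

Lemma viso_swap p c d (f : vert p -> vert (Node c d)) :
  viso f -> viso (@vswap c d \o f).
Proof.
case=> fi fs fr fc; split=> [||/=|x y /=].
- exact: inj_comp (can_inj (@vswapK c d)) fi.
- by move=> y; have [x Ex] := fs (vswap y); exists x; rewrite /= Ex vswapK.
- by rewrite fr.
- by rewrite vchild_swap fc.
Qed.

(** An isomorphism that is not straight becomes straight after exchanging the two subtrees of the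
    target. *)
Lemma niso_node a b c d : niso (Node a b) (Node c d) =
  (niso a c * niso b d + niso a d * niso b c)%N.
Proof.
pose sw c d (f : {ffun vert (Node a b) -> vert (Node c d)}) :=
  [ffun x => vswap (f x)].
have swK c' d' : cancel (sw c' d') (sw d' c').
  by move=> f; apply/ffunP => x; rewrite !ffunE vswapK.
rewrite -!card_straight -(card_imset _ (can_inj (swK d c))) /niso.
rewrite -(cardsID (straight a b c d)); congr (_ + _)%N; apply: eq_card => f.
  by rewrite !inE andbA andbb.
have swiso c' d' (g : {ffun vert (Node a b) -> vert (Node c' d')}) :
    viso g -> viso (sw c' d' g).
  move/viso_swap => h.
  suff -> : (sw c' d' g : _ -> _) = @vswap c' d' \o g by [].
  by apply/funext => x; rewrite ffunE.
apply/setDP/imsetP => [[/visosP fi]|[g]].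
  rewrite inE; move/visosP: (fi) => -> /= fl.
  exists (sw c d f); last by rewrite swK.
  rewrite inE; apply/andP; split; first by apply/visosP/swiso.
  rewrite ffunE; have [injf _ f0 cf] := fi.
  have := cf None (Some (inl (vroot a))); rewrite vchild_nl eqxx [f None]f0.
  case: (f _) fl => [[y|y]|] //=.
    by rewrite vchild_nl => /negP fl /eqP y0; case: fl; rewrite y0.
  by rewrite vchild_nr => _ /eqP->.
rewrite inE => /andP[/visosP gi /eqP gl] ->; split; first by apply/visosP/swiso.
by rewrite inE negb_and ffunE gl orbT.
Qed.

(* Adjacency determines the children because depth is preserved. *)
Lemma viso_adjacent p q (f : vert p -> vert q) :
  injective f -> (forall y, exists x, f x = y) ->
  (forall x, (f x == vroot q) = (x == vroot p)) ->
  (forall x y, vchild (f x) (f y) || vchild (f y) (f x) =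
               vchild x y || vchild y x) -> viso f.
Proof.
move=> injf sf rf af.
have szf v : size (vpath (f v)) = size (vpath v).
  have [d] := ubnP (size (vpath v)); elim: d => // d IH in v *.
  have [->|nv] := eqVneq v (vroot p).
    have /eqP-> : f (vroot p) == vroot q by rewrite rf.
    have /eqP-> : vpath (vroot p) == [::] by rewrite vpath_root.
    by have /eqP-> : vpath (vroot q) == [::] by rewrite vpath_root.
  have [u uv] := vparent nv; rewrite (vchild_size uv) ltnS => lt_ud.
  have := af u v; rewrite uv /= => /orP[/vchild_size->|fvu].
    by rewrite IH.
  (* Suppose [f v] is the parent of [f u]. Then the parent [w] of [u] is sent either to [f v] as
     well, against injectivity, or to a child of [f u], against the depths known by induction. *)
  have nu : u != vroot p.
    rewrite -rf; apply/eqP => fu0; by rewrite fu0 vchild_to_root in fvu.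
  have [w wu] := vparent nu; have szu := vchild_size wu.
  have := af w u; rewrite wu /= => /orP[fwu|/vchild_size].
    have /injf wv := vparent_uniq fwu fvu.
    by have := vchild_size uv; rewrite -wv szu; lia.
  have -> : size (vpath (f u)) = size (vpath u) by apply: IH.
  have -> : size (vpath (f w)) = size (vpath w) by apply: IH; lia.
  by lia.
have vc r (x y : vert r) : vchild x y =
    (vchild x y || vchild y x) && (size (vpath y) == (size (vpath x)).+1).
  case E: (vchild x y); first by rewrite (vchild_size E) eqxx.
  case E': (vchild y x) => //=; rewrite (vchild_size E'); apply/esym/negbTE.
  by apply/eqP; lia.
split=> // [|x y]; first by apply/eqP; rewrite rf.
by rewrite vc [RHS]vc af !szf.
Qed.

Lemma viso_root p q (f : vert p -> vert q) x :
  viso f -> (f x == vroot q) = (x == vroot p).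
Proof. by case=> fi _ <- _; rewrite (inj_eq fi). Qed.

Fact vpath_mem p (v : vert p) : vpath v \in verts (Some (ptree_of p)).
Proof. by apply/vpathP; exists v. Qed.

Definition vertex_of p (v : vert p) : vertex (Some (ptree_of p)) :=
  SeqSub (vpath_mem v).

Lemma vertex_of_bij p : bijective (@vertex_of p).
Proof.
have surj (x : vertex (Some (ptree_of p))) : {v | vertex_of v == x}.
  apply: sigW; have /vpathP[v Ev] := valP x.
  by exists v; apply/eqP/val_inj.
exists (fun x => sval (surj x)) => v; last exact/eqP/(svalP (surj v)).
have /eqP/(congr1 val) := svalP (surj (vertex_of v)); exact: vpath_inj.
Qed.

(** Conjugation with the bijections [vertex_of] matches the two kinds of isomorphism. *)
Lemma card_isos p q :
  #|isos (Some (ptree_of p)) (Some (ptree_of q))| = niso p q.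
Proof.
have [[kp kpK Kkp] [kq kqK Kkq]] := (vertex_of_bij p, vertex_of_bij q).
pose h (f : {ffun vert p -> vert q}) := [ffun x => vertex_of (f (kp x))].
have h_inj : injective h.
  move=> f g /ffunP fg; apply/ffunP => v; have := fg (vertex_of v).
  by rewrite !ffunE kpK => /(can_inj kqK).
have rootE r (v : vert r) : is_root (vertex_of v) = (v == vroot r).
  by rewrite -vpath_root.
have adjE r (v w : vert r) :
    adjacent (vertex_of v) (vertex_of w) = vchild v w || vchild w v.
  by [].
rewrite /niso -(card_imset _ h_inj); apply: eq_card => F.
apply/isosP/imsetP => [[Fb Fr Fa]|[f /visosP fi ->]].
  exists [ffun v => kq (F (vertex_of v))]; last first.
    by apply/ffunP => x; rewrite !ffunE Kkq Kkp.
  have E v : vertex_of (kq (F (vertex_of v))) = F (vertex_of v) by rewrite Kkq.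
  apply/visosP/viso_adjacent => [x y|y|x|x y]; rewrite ?ffunE.
  - move/(can_inj Kkq)/(bij_inj Fb); exact: (can_inj kpK).
  - case: Fb => G _ GK; exists (kp (G (vertex_of y))).
    by rewrite ffunE Kkp GK kqK.
  - by rewrite -!rootE E Fr.
  - by rewrite -!adjE !E Fa.
have [finj fs _ fc] := fi; split=> [|x|x y].
- have fs' y : {x | f x == y} by apply: sigW; have [x <-] := fs y; exists x.
  have fb : bijective f.
    exists (fun y => sval (fs' y)) => y; last exact/eqP/(svalP (fs' y)).
    exact/finj/eqP/(svalP (fs' (f y))).
  have hb := bij_comp (bij_comp (vertex_of_bij q) fb) (Bijective Kkp kpK).
  apply: (eq_bij hb) => x.
  by rewrite ffunE.
- by rewrite ffunE rootE viso_root // -rootE Kkp.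
- by rewrite !ffunE adjE !fc -adjE !Kkp.
Qed.

Lemma niso_sym p q : niso p q = niso q p.
Proof.
elim: p q => [|a IHa b IHb] [|c d] //;
  rewrite ?niso_leaf_node ?niso_node_leaf //.
by rewrite !niso_node !(IHa, IHb) [(niso d a * _)%N]mulnC.
Qed.

(** Read off the recursion [niso_node], without composing any isomorphisms. *)
Lemma niso_transl p q r : (0 < niso p q)%N -> niso p r = niso q r.
Proof.
elim: p q r => [|a IHa b IHb] [|c d] r;
  rewrite ?niso_leaf_node ?niso_node_leaf //.
rewrite niso_node addn_gt0 !muln_gt0; case: r => [|e f].
  by rewrite !niso_node_leaf.
rewrite !niso_node => /orP[] /andP[/IHa ha /IHb hb]; rewrite !ha !hb //.
by rewrite addnC ![(_ * niso c _)%N]mulnC.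
Qed.

Lemma niso_gt0 p : (0 < niso p p)%N.
Proof.
elim: p => [|a Ha b Hb]; first by rewrite niso_leaf.
by rewrite niso_node addn_gt0 muln_gt0 Ha Hb.
Qed.

Lemma niso_const p q : (0 < niso p q)%N -> niso p q = niso p p.
Proof. by move=> pq; rewrite niso_sym -(niso_transl p pq). Qed.

(** Isomorphic planar trees differ only by exchanging children, which a commutative [g] does not
    see. *)
Lemma niso_invariant (X : Type) (f : bintree -> X) (g : X -> X -> X) :
  commutative g -> (forall a b, f (Node a b) = g (f a) (f b)) ->
  forall p q, (0 < niso p q)%N -> f p = f q.
Proof.
move=> gC fN; elim=> [|a IHa b IHb] [|c d];
  rewrite ?niso_leaf_node ?niso_node_leaf //.
rewrite niso_node addn_gt0 !muln_gt0 !fN => /orP[] /andP[/IHa-> /IHb->] //.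
Qed.

Lemma niso_bleaves p q : (0 < niso p q)%N -> bleaves p = bleaves q.
Proof. by move=> /(niso_invariant addnC)->. Qed.

(** The recursion of [prune_fact] also uses [bleaves], so invariance is proved for the pair. *)
Lemma niso_prune_fact p q : (0 < niso p q)%N -> prune_fact p = prune_fact q.
Proof.
pose g (x y : nat * nat) := ((x.1 + y.1)%N, ((x.1 + y.1).-1 * (x.2 * y.2))%N).
have gC : commutative g by move=> x y; rewrite /g addnC [(x.2 * _)%N]mulnC.
move=> /(niso_invariant (f := fun p => (bleaves p, prune_fact p)) gC) H.
by have [] : (bleaves p, prune_fact p) = (bleaves q, prune_fact q) by apply: H.
Qed.

(** Enumeration by height, for the sake of a simple recursion. All trees with at most [d] leaves
    occur, but larger ones may too, so later sums filter by [bleaves]. *)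
Fixpoint bintrees d :=
  if d is d'.+1
  then Leaf :: [seq Node a b | a <- bintrees d', b <- bintrees d'] else [::].

Lemma mem_bintrees p d : (bleaves p <= d)%N -> p \in bintrees d.
Proof.
elim: d p => [|d IH] p; first by rewrite leqNgt bleaves_gt0.
case: p => [|a b] /=; first by rewrite inE eqxx.
move=> le; rewrite inE; apply/orP; right; apply/allpairsP; exists (a, b).
have := bleaves_gt0 a; have := bleaves_gt0 b.
by split=> //; apply: IH => /=; lia.
Qed.

Lemma big_bintrees (V : nmodType) d (F : bintree -> V) :
  \sum_(p <- bintrees d.+1) F p =
  F Leaf + \sum_(a <- bintrees d) \sum_(b <- bintrees d) F (Node a b).
Proof. by rewrite /= big_cons big_allpairs_dep. Qed.

(* Each planar tree of the class of [p] contributes [niso p p], so the class  *)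
(* consists of 2 ^ (bleaves p - 1) / niso p p planar trees.                   *)
Lemma sum_niso p d : (bleaves p <= d)%N ->
  (\sum_(q <- bintrees d) niso p q = 2 ^ (bleaves p).-1)%N.
Proof.
elim: p d => [|a IHa b IHb] [|d] //=.
- move=> _; rewrite big_cons niso_leaf big1_seq // => q /andP[_].
  by case/allpairsP => -[x y] [_ _ ->]; rewrite niso_leaf_node.
- by have := bleaves_gt0 a; lia.
move=> le; have [la lb] := (bleaves_gt0 a, bleaves_gt0 b).
rewrite big_cons niso_node_leaf add0n big_allpairs_dep.
under eq_bigr => x _ do under eq_bigr => y _ do rewrite niso_node.
under eq_bigr => x _ do rewrite big_split /=.
(* After exchanging x and y the crossed isomorphisms give the same sum as the straight ones, hence
   the factor 2. *)
rewrite big_split /= [X in (_ + X)%N]exchange_big /=.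
have E : (\sum_(x <- bintrees d) \sum_(y <- bintrees d) niso a x * niso b y =
          2 ^ (bleaves a + bleaves b).-2)%N.
  have [lea leb] : (bleaves a <= d)%N /\ (bleaves b <= d)%N by lia.
  under eq_bigr => x _ do rewrite -big_distrr /= IHb //.
  by rewrite -big_distrl /= IHa // -expnD; congr (_ ^ _)%N; lia.
rewrite E addnn -mul2n -expnS; congr (_ ^ _)%N; lia.
Qed.

(** * Sums over planar trees and over classes *)

Section Dotp.
Variables (n : nat) (K : comNzRingType).
Implicit Types f g : fps n K.

Lemma dotpC (u v : 'I_n -> fps n K) : dotp u v = dotp v u.
Proof. by apply: eq_bigr => i _; rewrite mulrC. Qed.

Lemma dotp_grad_sum I J (r : seq I) (s : seq J) (A : pred I) (B : pred J)
    (F : I -> fps n K) (H : J -> fps n K) :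
  dotp (grad (\sum_(i <- r | A i) F i)) (grad (\sum_(j <- s | B j) H j)) =
  \sum_(i <- r | A i) \sum_(j <- s | B j) dotp (grad (F i)) (grad (H j)).
Proof.
under [RHS]eq_bigr => i _ do rewrite exchange_big /=.
rewrite exchange_big /=; apply: eq_bigr => k _.
rewrite /grad !fderiv_sum mulr_suml; apply: eq_bigr => i _.
by rewrite mulr_sumr.
Qed.

Lemma dotp_gradZ a b f g :
  dotp (grad (a *: f)) (grad (b *: g)) = (a * b) *: dotp (grad f) (grad g).
Proof.
rewrite /dotp scaler_sumr; apply: eq_bigr => i _.
by rewrite /grad !fderivZ -fps_scalerAl -fps_scalerAr scalerA.
Qed.

End Dotp.

Definition Qbin n (R : comNzRingType) (P : fps n R) p := pQtree P (ptree_of p).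

(* 1 / bweight p is 1 / beta of the class of [p], divided by the size of that *)
(* class.                                                                     *)
Definition bweight p := (2 ^ (bleaves p).-1 * prune_fact p)%N.

Lemma bweight_node a b : bweight (Node a b) =
  (2 * (bleaves a + bleaves b).-1 * (bweight a * bweight b))%N.
Proof.
have [la lb] := (bleaves_gt0 a, bleaves_gt0 b); rewrite /bweight /=.
have -> : (bleaves a + bleaves b).-1 = ((bleaves a).-1 + (bleaves b).-1).+1.
  by lia.
by rewrite expnS expnD; ring.
Qed.

Section PlanarSum.
Variables (n : nat) (K : numFieldType) (P : fps n K) (q : nat -> fps n K).
Hypothesis q0 : q 0%N = P.
Hypothesis qS : forall k, q k.+1 *+ (2 * k.+1) =
  \sum_(l < k.+1) dotp (grad (q l)) (grad (q (k - l)%N)).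

Let term p := (bweight p)%:R^-1 *: Qbin P p.

Lemma scale_natr (V : lmodType K) j (x y : V) :
  (0 < j)%N -> x *+ j = y *+ j -> x = y.
Proof.
move=> j0 xy; have nz : (j%:R : K) != 0 by rewrite pnatr_eq0 -lt0n.
by apply: (scalerI nz); rewrite !scaler_nat.
Qed.

(** Strong induction: cutting a tree at its root turns the planar sum into the bilinear recursion of
    [q]. The bound [d] is free so that one list of subtrees serves all smaller sizes. *)
Lemma planar_sum m d : (m < d)%N ->
  \sum_(p <- bintrees d | bleaves p == m.+1) term p = q m.
Proof.
have [e] := ubnP m; elim: e => // e IH in m d *; rewrite ltnS => le_me.
case: d => // d; rewrite ltnS => le_md; rewrite big_mkcond big_bintrees /=.
case: m le_me le_md => [|k] le_ke le_kd.
  rewrite big1_seq ?addr0 /term /bweight ?muln1 ?invr1 ?scale1r ?q0 // => a _.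
  rewrite big1_seq // => b _; have := bleaves_gt0 a; have := bleaves_gt0 b.
  by case: eqP => // /eqP; lia.
rewrite add0r; apply: (@scale_natr _ (2 * k.+1)) => //; rewrite qS.
pose F a b := dotp (grad (term a)) (grad (term b)).
transitivity (\sum_(a <- bintrees d)
    \sum_(b <- bintrees d | bleaves a + bleaves b == k.+2) F a b).
  rewrite -sumrMnl; apply: eq_bigr => a _; rewrite [RHS]big_mkcond -sumrMnl.
  apply: eq_bigr => b _; case: eqP => [E|_]; last by rewrite mul0rn.
  rewrite /F /term dotp_gradZ -scaler_nat scalerA; congr (_ *: _).
  (* With k + 2 leaves in all, the root factor of the weight is 2 (k + 1), which the multiple
     cancels. *)
  rewrite bweight_node E [in X in _ * X]natrM [in X in _ * X]invfM mulrA divff.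
    by rewrite mul1r natrM invfM.
  by rewrite pnatr_eq0.
transitivity (\sum_(l < k.+1) \sum_(a <- bintrees d | bleaves a == l.+1)
    \sum_(b <- bintrees d | bleaves b == (k - l).+1) F a b); last first.
  apply: eq_bigr => l _; have := ltn_ord l; rewrite ltnS => le_lk.
  rewrite -(IH l d) ?(leq_trans _ le_ke) ?(leq_trans _ le_kd) //.
  rewrite -(IH (k - l)%N d); [|by lia|by lia].
  by rewrite dotp_grad_sum.
(* Each [a] belongs to the single index l = [(bleaves a).-1]; if that is too large, no [b] can
   complete it. *)
rewrite [RHS](exchange_big_dep xpredT) //=; apply: eq_bigr => a _.
have la := bleaves_gt0 a; have [lt_ak|le_ka] := ltnP (bleaves a).-1 k.+1.
  rewrite (big_pred1 (Ordinal lt_ak)) => [|l]; last first.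
    by rewrite /= -val_eqE /=; lia.
  by apply: eq_bigl => b /=; have := bleaves_gt0 b; lia.
rewrite [RHS]big1 => [|l /eqP E]; last by have := ltn_ord l; lia.
by rewrite big1 // => b /eqP; have := bleaves_gt0 b; lia.
Qed.

End PlanarSum.

Lemma ptree_of_inj : injective ptree_of.
Proof. by elim=> [|a IHa b IHb] [|c d] //= [/IHa-> /IHb->]. Qed.

(** * From planar trees to isomorphism classes *)

Section Classes.

Definition btree_of p : btree :=
  exist _ (Some (ptree_of p)) (binary_ptree_of p).
Definition bclass p : BB := (\pi_BB (btree_of p))%qT.

Lemma isomorphic_ptree_of p q :
  isomorphic (Some (ptree_of p)) (Some (ptree_of q)) = (0 < niso p q)%N.
Proof.
rewrite -card_isos card_gt0; apply/existsP/set0Pn => -[f fi]; by exists f.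
Qed.

Lemma bclass_eq p q : (bclass p == bclass q) = (0 < niso p q)%N.
Proof.
rewrite -isomorphic_ptree_of.
by apply/eqP/idP => [/eqmodP|h]; last exact/eqmodP.
Qed.

Lemma BBrepP (T : BB) :
  (T = BBempty /\ BBrep T = None) \/
  (exists2 p, BBrep T = Some (ptree_of p) & T = bclass p).
Proof.
have ET : T = (\pi_BB (repr T))%qT by rewrite reprK.
rewrite /BBrep; case: (repr T) ET => -[t|] tbin ET.
  right; have [p Ep] := binaryP tbin; subst t; exists p => //.
  by rewrite ET; congr (\pi_BB _)%qT; apply: val_inj.
by left; split=> //; rewrite ET; congr (\pi_BB _)%qT; apply: val_inj.
Qed.

Lemma bclass_neq_empty p : bclass p <> BBempty.
Proof.
move/eqmodP/isomorphicP => [f _].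
by case: (f (vertex_of (vroot p))).
Qed.

(** The chosen representative of the class of [p] need not be [p] itself, so quantities read through
    it require invariance under isomorphism. *)
Lemma BBrep_bclass p :
  exists2 q, BBrep (bclass p) = Some (ptree_of q) & (0 < niso p q)%N.
Proof.
have [[/bclass_neq_empty]|[q Eq cpq]] // := BBrepP (bclass p).
by exists q => //; rewrite -bclass_eq cpq.
Qed.

Lemma BBrep_empty : BBrep BBempty = None.
Proof. by have [[]|[p _ /esym/bclass_neq_empty]] // := BBrepP BBempty. Qed.

Definition classes m : seq BB :=
  undup [seq bclass p | p <- bintrees m & bleaves p == m].

Lemma BB_nleavesE m : (0 < m)%N -> BB_nleaves m = [set` classes m]%classic.
Proof.
move=> m0; apply/seteqP; split=> T /=; rewrite mem_undup.
  case: (BBrepP T) => [[_ TN]|[p Tp ->]]; rewrite /BB_nleaves /=.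
    by rewrite TN nleavesE /= => m00; rewrite -m00 in m0.
  have [q Eq pq] := BBrep_bclass p.
  rewrite Eq nleaves_ptree_of -(niso_bleaves pq) => lp.
  by apply: map_f; rewrite mem_filter lp eqxx mem_bintrees ?lp.
case/mapP => p; rewrite mem_filter => /andP[/eqP lp _] ->.
have [q Eq pq] := BBrep_bclass p.
by rewrite /BB_nleaves /= Eq nleaves_ptree_of -(niso_bleaves pq).
Qed.

Lemma BB_nvertsE m : (0 < m)%N -> BB_nverts (2 * m - 1) = BB_nleaves m.
Proof.
move=> m0; apply/seteqP; split=> T; rewrite /BB_nverts /BB_nleaves /=;
  case: (BBrepP T) => [[_ ->]|[p -> _]];
  rewrite ?nverts_ptree_of ?nleaves_ptree_of ?nvertsE ?nleavesE /=; lia.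
Qed.

Variables (n : nat) (K : numFieldType) (P : fps n K).

Definition treeterm (T : BB) : fps n K := (beta T)%:R^-1 *: Qtree P T.

Lemma Qbin_niso p q : (0 < niso p q)%N -> Qbin P p = Qbin P q.
Proof.
pose g (f h : fps n K) := dotp (grad f) (grad h).
exact: (@niso_invariant _ (Qbin P) g (fun f h => dotpC _ _)).
Qed.

Lemma betaE (T : BB) p :
  BBrep T = Some (ptree_of p) -> beta T = (niso p p * prune_fact p)%N.
Proof. by rewrite /beta => ->; rewrite /alpha card_isos tfact_prune. Qed.

(** The class of [q] has 2^(m-1) / [niso q q] planar members, all with the weight 1 / (2^(m-1)
    [prune_fact q]); together they weigh 1 / beta. *)
Lemma classes_sum m : (0 < m)%N ->
  \sum_(T <- classes m) treeterm T =
  \sum_(p <- bintrees m | bleaves p == m) (bweight p)%:R^-1 *: Qbin P p.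
Proof.
move=> m0.
transitivity (\sum_(T <- classes m)
   \sum_(p <- bintrees m | (bleaves p == m) && (bclass p == T))
   (bweight p)%:R^-1 *: Qbin P p); last first.
  rewrite (exchange_big_dep (fun p => bleaves p == m)) /=; last first.
    by move=> T p _ /andP[].
  rewrite [LHS]big_seq_cond [RHS]big_seq_cond.
  apply: eq_bigr => p /andP[pm lp].
  have pc : bclass p \in classes m.
    by rewrite mem_undup; apply: map_f; rewrite mem_filter lp pm.
  rewrite big_mkcond (bigD1_seq _ pc (undup_uniq _)) /= lp eqxx big1 ?addr0 //.
  by move=> T; rewrite eq_sym => /negbTE->.
rewrite [LHS]big_seq [RHS]big_seq; apply: eq_bigr => T.
rewrite mem_undup => /mapP[p0]; rewrite mem_filter => /andP[/eqP lp0 _] ET.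
have [q Eq p0q] := BBrep_bclass p0; rewrite -ET in Eq.
have Tq : T = bclass q.
  by have [[_]|[r]] := BBrepP T; rewrite Eq // => -[/ptree_of_inj->].
have lq : bleaves q = m by rewrite -(niso_bleaves p0q).
rewrite /treeterm (betaE Eq) Eq.
transitivity
  (\sum_(p <- bintrees m | (0 < niso q p)%N) (bweight q)%:R^-1 *: Qbin P q).
  rewrite -scaler_suml; congr (_ *: _).
  have nz j : (0 < j)%N -> (j%:R : K) != 0 by rewrite pnatr_eq0 -lt0n.
  (* The ratio of [niso q p] to [niso q q] is the indicator of the class of [q]; [sum_niso]
     evaluates the sum. *)
  transitivity
    (\sum_(p <- bintrees m) (niso q p)%:R / (niso q q * bweight q)%:R : K).
    rewrite -mulr_suml -natr_sum sum_niso ?lq // -lq /bweight !natrM.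
    have [h1 h2] := (nz _ (prune_fact_gt0 q), nz _ (niso_gt0 q)).
    by field; rewrite h1 h2 pnatr_eq0 expn_eq0.
  rewrite [RHS]big_mkcond; apply: eq_bigr => p _.
  case: posnP => [->|/niso_const->]; first by rewrite mul0r.
  by rewrite natrM invfM mulrA divff ?mul1r ?nz ?niso_gt0.
apply: congr_big => // p.
  rewrite Tq bclass_eq (niso_sym p q); case H: (0 < niso q p)%N.
    by rewrite -(niso_bleaves H) lq eqxx.
  by rewrite andbF.
move=> qp; rewrite (Qbin_niso qp).
by rewrite /bweight -(niso_bleaves qp) -(niso_prune_fact qp).
Qed.

End Classes.

(** * Orders of tree series, finiteness, and the expansions *)

Lemma ord_ge_fderiv n (R : comNzRingType) d (f : fps n R) i :
  ord_ge d.+1 f -> ord_ge d (fderiv i f).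
Proof.
move=> hf m /=; have [->|/hf] := eqVneq (f (m + U_(i))%MM) 0.
  by rewrite mul0rn eqxx.
by rewrite mdegD mdeg1 addn1.
Qed.

(** Each gradient costs one degree: (a + 2 - 1) + (b + 2 - 1) = (a + b) + 2. Starting from order 2
    the same count would stay at 2. *)
Lemma ord_ge_Qbin n (R : comNzRingType) (P : fps n R) p :
  ord_ge 3 P -> ord_ge (bleaves p).+2 (Qbin P p).
Proof.
move=> hP; elim: p => [|a IHa b IHb] //.
pose D i := grad (Qbin P a) i * grad (Qbin P b) i.
move=> m; rewrite -[Qbin _ _]/(\sum_i D i) fps_sumE => nz.
case: (pickP (fun i => D i m != 0)) => [i|all0]; last first.
  by move: nz; rewrite big1 ?eqxx // => i _; apply/eqP/negPn; rewrite all0.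
suff h : ord_ge (bleaves (Node a b)).+2 (D i) by move/h.
rewrite [bleaves _]/= -addnS -addSn; apply: ord_geM; exact: ord_ge_fderiv.
Qed.

Lemma BBrep_nonempty (T : BB) :
  T <> BBempty -> exists p, BBrep T = Some (ptree_of p).
Proof. by have [[]|[p Tp _] _] := BBrepP T; last by exists p. Qed.

Lemma nleaves_gt0 (T : BB) : T <> BBempty -> (0 < nleaves T)%N.
Proof.
by move/BBrep_nonempty => [p ->]; rewrite nleaves_ptree_of bleaves_gt0.
Qed.

Lemma BB_nleaves_nonempty m (T : BB) :
  (0 < m)%N -> nleaves T = m -> T <> BBempty.
Proof.
by move=> m0 Tm TN; rewrite TN BBrep_empty nleavesE /= in Tm; rewrite -Tm in m0.
Qed.

Lemma BB_nleaves_finite m : (0 < m)%N -> finite_set (BB_nleaves m).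
Proof. by move=> m0; rewrite BB_nleavesE //; apply: finite_seq. Qed.

Lemma mem_classes m (T : BB) :
  (0 < m)%N -> (T \in classes m) = (nleaves T == m).
Proof.
move=> m0; have := BB_nleavesE m0 => /seteqP[h1 h2].
by apply/idP/eqP => [/h2|/h1].
Qed.

Theorem theorem5p2 (R : realType) (n : nat) (hn : (0 < n)%N)
    (P : fps n R[i]) (hP : ord_ge 2 P)
    (Qt : fps n.+1 R[i]) (hQt : zord_ge 2 Qt)
    (hinv : zformal_inverse
              (fun i => zvar i + tvar * zgrad Qt i)
              (fun i => zvar i - tvar * inj_z (grad P i))) :
  let G (T : BB) : fps n R[i] := (beta T)%:R^-1 *: Qtree P T in
  let F (T : BB) : fps n.+1 R[i] := tvar ^+ (nleaves T).-1 * inj_z (G T) in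
  [/\ (* the coefficients of Q_t *)
      forall m : nat, (1 <= m)%N ->
        tcoef m.-1 Qt = \sum_(T \in BB_nverts (2 * m - 1)) G T
        /\ tcoef m.-1 Qt = \sum_(T \in BB_nleaves m) G T,
      (* the expansion of Q_t in C[[z,t]] *)
      fps_summable BB_nonempty F /\ Qt = fps_sum BB_nonempty F,
      (* the expansion of Q in C[[z]], when its right-hand side exists *)
      forall Q : fps n R[i], ord_ge 2 Q ->
        formal_inverse (fun i => fvar _ i + grad Q i)
                       (fun i => fvar _ i - grad P i) ->
        fps_summable BB_nonempty G -> Q = fps_sum BB_nonempty G &
      (* which is always the case if o(P) >= 3 *)
      ord_ge 3 P -> fps_summable BB_nonempty G].
Proof.
move=> G F.
have P0 : P 0%MM = 0 by have [//|/hP] := eqVneq (P 0%MM) 0; rewrite mdeg0.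
have tcoefE' k : tcoef k Qt = \sum_(T <- classes k.+1) G T.
  rewrite (classes_sum P (ltn0Sn k)); symmetry.
  pose q l := tcoef l Qt.
  exact: (@planar_sum _ _ _ q (tcoef0_Qt hQt hinv P0) (tcoef_rec hQt hinv)).
have FE T m : F T m = if m ord_max == (nleaves T).-1 then G T (zpart m) else 0.
  exact: tvar_exp_inj_z.
split.
- move=> m m0; rewrite BB_nvertsE // BB_nleavesE //.
  by rewrite -fsbig_seq ?undup_uniq // tcoefE' prednK.
- split=> [m|].
    apply: sub_finite_set (BB_nleaves_finite (ltn0Sn (m ord_max))) => T.
    (* Positivity matters: [.-1] would give 0 leaves and 1 leaf the same power of t. *)
    case=> /nleaves_gt0 T0; rewrite FE.
    case: (m ord_max =P _) => [->|]; last by rewrite eqxx.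
    by rewrite /BB_nleaves /= prednK.
  apply: fpsP => m; pose k := m ord_max.
  rewrite -{1}(mon_zt_zpart m) -tcoefE tcoefE' fps_sumE.
  rewrite -[RHS]/(\sum_(T \in BB_nonempty) F T m).
  rewrite (fsbigE (classes k.+1)) ?undup_uniq //; first last.
  + move=> T /nleaves_gt0 T0; rewrite mem_classes // FE => nT.
    case: (m ord_max =P _) => // E.
    by rewrite /k E prednK ?eqxx in nT.
  + by move=> T /=; rewrite mem_classes // => /eqP/BB_nleaves_nonempty; apply.
  rewrite [LHS]big_seq [RHS]big_seq_cond; apply: eq_big => T.
    rewrite mem_classes //; case: eqP => //= /BB_nleaves_nonempty nT.
    by apply/esym/mem_set/nT.
  by rewrite mem_classes // FE => /eqP->; rewrite eqxx.
- move=> Q hQ hQinv hG.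
  have Nex a : {s : seq BB | uniq s &
                  forall T, T \in s <-> T <> BBempty /\ G T a != 0}.
    have /finite_seqP/cid[s Es] := hG a.
    exists (undup s); first exact: undup_uniq.
    move=> T; rewrite mem_undup; move/seteqP: Es => [h1 h2].
    by split=> [/h2|/h1].
  (* Summability makes the support at [a] finite. As the coefficient of t^k involves trees with k +
     1 leaves, it vanishes at [a] as soon as k reaches the largest leaf number [N a]. *)
  pose supp a := s2val (Nex a); pose N a := \max_(T <- supp a) nleaves T.
  have leN a T : T <> BBempty -> G T a != 0 -> (nleaves T <= N a)%N.
    move=> T0 Ta; have : T \in supp a by apply/(s2valP' (Nex a)).
    by move=> Ts; rewrite /N (bigD1_seq T) ?(s2valP (Nex a)) //= leq_maxl.
  have hN a k : (N a <= k)%N -> tcoef k Qt a = 0.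
    move=> le_Nk; rewrite tcoefE' fps_sumE big1_seq // => T /andP[_].
    rewrite mem_classes // => /eqP Tk; apply/eqP; apply: contraT => Ta.
    have := leN a T (BB_nleaves_nonempty (ltn0Sn k) Tk) Ta.
    by rewrite Tk leqNgt ltnS le_Nk.
  apply: fpsP => a.
  rewrite (inverse_specialization hP hQt hinv hN hQ hQinv).
  rewrite -[RHS]/(\sum_(T \in BB_nonempty) G T a).
  have us := s2valP (Nex a).
  rewrite (fsbigE (supp a)) //; first last.
  + move=> T T0 Ts; apply/eqP; apply: contraNT Ts => Ta.
    by apply/(s2valP' (Nex a)).
  + by move=> T /= /(s2valP' (Nex a))[].
  (* The support is regrouped by number of leaves, one coefficient of [Qt] for each. *)
  transitivity (\sum_(k < N a) \sum_(T <- supp a | nleaves T == k.+1) G T a).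
    apply: eq_bigr => k _; rewrite tcoefE' fps_sumE.
    rewrite (bigfs _ us) => [|T /eqP Tk Ts]; last first.
      apply/eqP; apply: contraNT Ts => Ta; apply/(s2valP' (Nex a)); split=> //.
      exact: BB_nleaves_nonempty (ltn0Sn k) Tk.
    rewrite [LHS]fsbig_seq ?undup_uniq //; apply: eq_fsbigl.
    by apply/seteqP; split=> T /=; rewrite mem_classes.
  rewrite (exchange_big_dep xpredT) //= [RHS]big_seq_cond [LHS]big_seq_cond.
  apply: eq_big => [T|T /andP[Ts _]].
    rewrite andbT; case Ts: (T \in supp a) => //=.
    by apply/esym/mem_set; case/(s2valP' (Nex a)): Ts.
  have [T0 Ta] := (s2valP' (Nex a) T).1 Ts.
  have lt_N : ((nleaves (BBrep T)).-1 < N a)%N.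
    by rewrite prednK ?leN // nleaves_gt0.
  rewrite (big_pred1 (Ordinal lt_N)) // => k; rewrite /= -val_eqE /=.
  by rewrite -[in LHS](prednK (nleaves_gt0 T0)) eqSS eq_sym.
move=> hP3 m.
(* By [ord_ge_Qbin] a tree that contributes to [m] has at most [mdeg m - 2] leaves, so this finite
   union contains them all. *)
pose A := (\bigcup_(k in `I_(mdeg m)) BB_nleaves k.+1)%classic.
apply: (@sub_finite_set _ _ A).
  move=> T [T0 Tm]; have T1 := nleaves_gt0 T0.
  exists (nleaves T).-1; last by rewrite /BB_nleaves /= prednK.
  have [p Tp] := BBrep_nonempty T0; move: Tm; rewrite /G Tp nleaves_ptree_of.
  have [|/(ord_ge_Qbin hP3)] := eqVneq (Qbin P p m) 0.
    by rewrite fpsZE -[Qtree _ _]/(Qbin P p) => ->; rewrite mulr0 eqxx.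
  by rewrite /=; lia.
apply: bigcup_finite => [|k _]; first exact: finite_II.
exact: BB_nleaves_finite.
Qed.
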